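(* Let $G(\mathcal V,\mathcal E)$ be a directed graph satisfying Assumption 1 (see context), and let $\mathcal F\subseteq\mathcal V$, $|\mathcal F|\le f$, be the set of Byzantine agents of an execution of Algorithm 2, with $\mathcal N=\mathcal V-\mathcal F$ and $\phi_i=|N_i^-\cap\mathcal F|$. Let $$\tilde\beta=\min\Big\{\frac{1}{2\max_{i\in\mathcal N}(d_i^-+1-\phi_i-f)},\ \frac1{|\mathcal N|}\Big\},\qquad \tilde\gamma=\min_{i\in\mathcal N}(d_i^-+1-\phi_i-f).$$ For each $t\ge0$ let $z[t]=x_{j_t}[t]$, where $j_t\in\arg\max_{j\in\mathcal N}\mathrm{Dist}\big(x_j[t],Y(\tilde\beta,\tilde\gamma)\big)$. Then the sequence $\{\mathrm{Dist}(z[t],Y(\tilde\beta,\tilde\gamma))\}_{t=0}^\infty$ converges and $$\lim_{t\to\infty}\mathrm{Dist}\big(z[t],Y(\tilde\beta,\tilde\gamma)\big)=0.$$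
   Context: **System.** A synchronous system of $n$ agents $\mathcal V=\{1,\dots,n\}$ communicates over a directed graph $G(\mathcal V,\mathcal E)$ without self-loops. $N_i^-=\{j:(j,i)\in\mathcal E\}$ and $d_i^-=|N_i^-|$. Up to $f$ agents are Byzantine: they may behave arbitrarily, in particular send different arbitrary real values to different out-neighbours. $\mathcal F$ is the set of faulty agents. **Local functions.** $\mathcal X\subseteq\mathbb R$ is a nonempty closed convex set and $L$ is a fixed constant. Each agent $i$ has an admissible function $h_i:\mathcal X\to\mathbb R$: convex, continuously differentiable, $h_i'$ is $L$-Lipschitz, $|h_i'(x)|\le L$ on $\mathcal X$, and $\arg\min_{x\in\mathcal X}h_i(x)$ is nonempty and compact. $P_{\mathcal X}$ is the projection onto $\mathcal X$; $\mathrm{Dist}(x,S)=\inf_{y\in S}|x-y|$. **Reduced graphs.** For a faulty set $\mathcal F$, a reduced graph under Byzantine faults is any subgraph of $G$ obtained by removing all agents of $\mathcal F$ with their edges and then removing up to $f$ additional incoming edges at each agent of $\mathcal N$. A source component of a graph is the (nonempty) collection of all agents each of which has a directed path to every other agent of the graph. Assumption 1: for every possible faulty set of size at most $f$, every reduced graph contains a source component (this implies that the in-degrees are large enough for the trimming below to make sense). **Valid functions.** $\mathcal A(\beta,\gamma)$ is the set of functions $p=\sum_{i\in\mathcal N}\alpha_ih_i$ with $\alpha_i\ge0$, $\sum_{i\in\mathcal N}\alpha_i=1$ and $|\{i\in\mathcal N:\alpha_i\ge\beta\}|\ge\gamma$; $Y(\beta,\gamma)=\bigcup_{p\in\mathcal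 A(\beta,\gamma)}\arg\min_{x\in\mathcal X}p(x)$. **Stepsizes.** $\lambda[t]>0$, $\lambda[t+1]\le\lambda[t]$ for $t\ge 0$, $\sum_t\lambda[t]=\infty$, $\sum_t\lambda^2[t]<\infty$. **Algorithm 2.** Each agent $j$ has an initial state $x_j[0]\in\mathcal X$. In iteration $t\ge1$ each non-faulty agent $j$: (1) sends the pair $(x_j[t-1],h_j'(x_j[t-1]))$ on all outgoing edges; (2) receives a pair $(w_i[t-1],g_i[t-1])$ from each $i\in N_j^-$ (a missing pair is replaced by some default pair; for non-faulty $i$, $w_i[t-1]=x_i[t-1]$ and $g_i[t-1]=h_i'(x_i[t-1])$), and puts $w_j[t-1]=x_j[t-1]$, $g_j[t-1]=h_j'(x_j[t-1])$; (3) sorts the $d_j^-$ received first entries, discards the $f$ smallest and $f$ largest (ties broken arbitrarily), and lets $\mathcal R_j^1[t-1]$ be the senders of the remaining $d_j^--2f$ first entries; sorts the $d_j^-$ received second entries together with its own gradient $h_j'(x_j[t-1])$, discards the $f$ smallest and $f$ largest, lets $\hat g_j[t-1]$ and $\check g_j[t-1]$ be the largest and smallest of the remaining $d_j^-+1-2f$ values, sets $\widetilde g_j[t-1]=\frac12(\hat g_j[t-1]+\check g_j[t-1])$, and updates $$x_j[t]=P_{\mathcal X}\Big[\tfrac1{d_j^-+1-2f}\sum_{i\in\mathcal R_j^1[t-1]\cup\{j\}}w_i[t-1]-\lambda[t-1]\,\widetilde g_j[t-1]\Big].$$ *)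

(* Defs.v *)
From HB Require Import structures.
From mathcomp Require Import all_boot all_order all_algebra.
From mathcomp Require Import all_classical all_reals all_analysis.
Set Implicit Arguments.
Unset Strict Implicit.
Unset Printing Implicit Defensive.
Import Order.TTheory GRing.Theory Num.Theory.
Import numFieldNormedType.Exports.
Local Open Scope classical_set_scope.
Local Open Scope ring_scope.

Section Graphs.
Variable n : nat.
Implicit Types (e : rel 'I_n) (F : {set 'I_n}).

(* [e i j] is the directed edge from [i] to [j]. *)
Definition in_nbrs e (j : 'I_n) : {set 'I_n} := [set i | e i j]%SET.

Definition indeg e (j : 'I_n) : nat := #|in_nbrs e j|.

(* The vertices of the reduced graph are the agents outside [F]; [e'] is its
   edge relation. *)
Definition reduced_graph e F (f : nat) (e' : rel 'I_n) : Prop :=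
  (forall i j, e' i j -> [/\ i \notin F, j \notin F & e i j]) /\
  (forall j, j \notin F ->
     #|[set i | [&& i \notin F, e i j & ~~ e' i j]]%SET| <= f)%N.

(* [connect e'] is reflexive, so the agent itself imposes no condition. *)
Definition source_component (V : {set 'I_n}) (e' : rel 'I_n) : {set 'I_n} :=
  [set i in V | [forall j in V, connect e' i j]]%SET.

Definition assumption1 e (f : nat) : Prop :=
  forall (F : {set 'I_n}) (e' : rel 'I_n),
    (#|F| <= f)%N -> reduced_graph e F f e' ->
    source_component (~: F) e' != finset.set0.

End Graphs.

Section Functions.
Variable R : realType.
Implicit Types (X S : set R) (h dh : R -> R).

Definition argmin X h : set R :=
  [set x | X x /\ forall y, X y -> h x <= h y].

(* Extended-real valued, so that the distance to the empty set is +oo. *)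
Definition Dist (x : R) S : \bar R := ereal_inf [set `|x - y|%:E | y in S].

Definition proj_on X (y : R) : R := xget 0 (argmin X (fun p => `|y - p|)).

(* [h] is only meaningful on [X], so its derivative at a point of [X] is the
   limit of the difference quotients within [X] (one-sided at endpoints). *)
Definition is_derivative_on X h dh : Prop :=
  forall x, X x ->
    (h y - h x) / (y - x) @[y --> within X x^'] --> dh x.

Record admissible X (L : R) h dh : Prop := Admissible {
  adm_convex : @convex_function R R^o X h;
  adm_deriv : is_derivative_on X h dh;
  adm_C1 : {within X, continuous dh};
  adm_lipschitz : L.-lipschitz_X dh;
  adm_bound : forall x, X x -> `|dh x| <= L;
  adm_argmin_nonempty : argmin X h !=set0;
  adm_argmin_compact : compact (argmin X h) }.

Definition stepsizes (lam : nat -> R) : Prop :=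
  [/\ forall t, 0 < lam t,
      forall t, lam t.+1 <= lam t,
      series lam @ \oo --> +oo &
      cvgn (series (fun t => lam t ^+ 2))].

End Functions.

Section Valid.
Variables (R : realType) (n : nat).
Variables (X : set R) (h : 'I_n -> R -> R) (F : {set 'I_n}).

Definition valid_functions (beta : R) (gamma : nat) : set (R -> R) :=
  [set p | exists alpha : 'I_n -> R,
    [/\ p = (fun x => \sum_(i in ~: F) alpha i * h i x),
        forall i, i \notin F -> 0 <= alpha i,
        \sum_(i in ~: F) alpha i = 1 &
        (gamma <= #|[set i in (~: F)%SET | (beta <= alpha i)%R]%SET|)%N]].

Definition Yset (beta : R) (gamma : nat) : set R :=
  \bigcup_(p in valid_functions beta gamma) argmin X p.

End Valid.

(* Discards the [f] first and [f] last entries of a list, meant to be sorted. *)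
Definition trim (T : Type) (f : nat) (s : seq T) : seq T :=
  drop f (take (size s - f) s).

Section Algorithm.
Variables (R : realType) (n : nat).
Variables (e : rel 'I_n) (f : nat) (F : {set 'I_n}).
Variables (X : set R) (dh : 'I_n -> R -> R) (lam : nat -> R).
Variables (x : nat -> 'I_n -> R) (w g : nat -> 'I_n -> 'I_n -> R).

(* [w t i j] and [g t i j] are the entries of the pair that [j] holds from [i]
   at time [t] (defaults included), for [i] an in-neighbour of [j] or [j]
   itself.  They are arbitrary for faulty [i]. *)
Definition honest_messages : Prop :=
  forall t i j, i \notin F -> w t i j = x t i /\ g t i j = dh i (x t i).

(* Possible sets of senders whose first entry is kept; [s] is any list of the
   in-neighbours sorted by first entry, which leaves ties arbitrary. *)
Definition kept_senders (t : nat) (j : 'I_n) (R1 : {set 'I_n}) : Prop :=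
  exists s : seq 'I_n,
    [/\ perm_eq s (enum (in_nbrs e j)),
        sorted (fun a b => w t a j <= w t b j) s &
        R1 = [set i in trim f s]%SET].

Definition kept_gradients (t : nat) (j : 'I_n) : seq R :=
  trim f (sort <=%R [seq g t i j | i <- enum (j |: in_nbrs e j)%SET]).

Definition trimmed_gradient (t : nat) (j : 'I_n) : R :=
  (last 0 (kept_gradients t j) + head 0 (kept_gradients t j)) / 2.

Definition update (t : nat) (j : 'I_n) : Prop :=
  exists2 R1 : {set 'I_n}, kept_senders t j R1 &
    x t.+1 j =
      proj_on X ((\sum_(i in (R1 :|: [set j])%SET) w t i j)
                / (indeg e j + 1 - 2 * f)%N%:R
              - lam t * trimmed_gradient t j).

(* The states of faulty agents after time 0 are unconstrained and unused. *)
Definition execution : Prop :=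
  [/\ forall j, X (x 0%N j),
      honest_messages &
      forall t j, j \notin F -> update t j].

End Algorithm.

Section Constants.
Variables (R : realType) (n : nat).
Variables (e : rel 'I_n) (f : nat) (F : {set 'I_n}).

(* Truncated subtraction is harmless: under [assumption1] one has
   2 * f <= indeg e i, and at most f in-neighbours are faulty. *)
Definition eff_deg (i : 'I_n) : nat :=
  (indeg e i + 1 - #|(in_nbrs e i :&: F)%SET| - f)%N.

Definition betat : R :=
  Num.min (1 / (2 * (\max_(i in ~: F) eff_deg i)%:R)) (1 / #|~: F|%:R).

(* Absent self-loops eff_deg i <= n, so [n] is neutral for this minimum. *)
Definition gammat : nat := \big[minn/n]_(i in ~: F) eff_deg i.

End Constants.

(* Main.v *)
(* Every trimmed average is a convex combination of non-faulty states, and an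
   agent with more than f in-neighbours (or itself) well inside the current range
   moves inwards by a fixed proportion. Since reduced graphs have a source
   component, of the two halves of the range at least one spreads its influence to
   all agents within n rounds, so the spread contracts up to an error that vanishes
   with the stepsize: consensus.

   The trimmed gradient of an agent lies between two combinations of non-faulty
   gradients whose weights come from a finite family of valid weights. If all
   states exceed every stationary point for that family by some margin, these
   combinations are bounded below by a positive constant, and the divergence of
   the stepsizes drives the largest state down; symmetrically for the smallest
   state. As the valid weights are star-shaped around the uniform weight, points
   between two stationary points minimise a valid function, so the states approach
   the set of such minimisers. *)
Require Import Defs.
From HB Require Import structures.
From mathcomp Require Import all_boot all_order all_algebra.
From mathcomp Require Import all_classical all_reals all_analysis.
From mathcomp Require Import zify ring lra.
Set Implicit Arguments.
Unset Strict Implicit.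
Unset Printing Implicit Defensive.
Import Order.TTheory GRing.Theory Num.Theory.
Import numFieldNormedType.Exports.
Local Open Scope classical_set_scope.
Local Open Scope ring_scope.

(** * In-degrees and spread of influence under the graph assumption *)

Section GraphLemmas.
Import mathcomp.boot.fintype mathcomp.boot.finset.
Local Open Scope nat_scope.
Local Open Scope set_scope.
Variables (n f : nat) (e : rel 'I_n).
Implicit Types (F S T : {set 'I_n}) (i j : 'I_n).

Lemma subset_of_card (I : finType) (A : {set I}) k :
  k <= #|A| -> exists2 B : {set I}, B \subset A & #|B| = k.
Proof.
move=> /card_geqP[s [us ss sA]]; exists [set x in s].
  by apply/subsetP=> x; rewrite inE; apply: sA.
by rewrite cardsE (card_uniqP us).
Qed.

Lemma connect_closed_pred (I : finType) (r : rel I) (S : pred I) x y :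
  (forall a b, r a b -> S b -> S a) -> connect r x y -> S y -> S x.
Proof.
move=> rS /connectP[p pP ->]; elim: p x pP => //= a p IH x /andP[xa pP] Sl.
by apply: rS xa _; apply: IH.
Qed.

Lemma source_componentP (V : {set 'I_n}) (r : rel 'I_n) :
  source_component V r != set0 ->
  exists2 s, s \in V & forall j, j \in V -> connect r s j.
Proof.
move=> /set0Pn[s]; rewrite inE => /andP[sV /forall_inP sP].
by exists s.
Qed.

(** If all agents could be faulty, the reduced graph without vertices would have no source. *)
Lemma assumption1_card : assumption1 e f -> f < n.
Proof.
move=> A1; rewrite ltnNge; apply/negP => nf.
have red : reduced_graph e setT f (fun _ _ => false).
  by split=> // j; rewrite inE.
have Ff : #|[set: 'I_n]| <= f by rewrite cardsT card_ord.
have /source_componentP[s] := A1 _ _ Ff red.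
by rewrite setCT inE.
Qed.

Hypothesis e_irr : irreflexive e.

(* Otherwise a faulty set inside the in-neighbourhood of [j] leaves [j] with at
   most [f] in-neighbours; after their removal, and that of the edges out of
   [j], the agent [j] is isolated. *)
Lemma indeg_gt j : assumption1 e f -> 0 < f -> 2 * f < indeg e j.
Proof.
move=> A1 f0; rewrite ltnNge; apply/negP => df.
have [F0 F0s F0c] := subset_of_card (geq_minr f #|in_nbrs e j|).
have jF0 : j \notin F0.
  by apply/negP => /(subsetP F0s); rewrite inE e_irr.
pose e0 : rel 'I_n := fun a b =>
  [&& a \notin F0, b \notin F0, e a b, a != j & b != j].
have F0f : #|F0| <= f by rewrite F0c geq_minl.
have red0 : reduced_graph e F0 f e0.
  split=> [a b /and5P[? ? ? _ _] // | b bF].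
  case: (eqVneq b j) => [-> | bj].
    apply: (@leq_trans #|in_nbrs e j :\: F0|).
      by apply: subset_leq_card; apply/subsetP=> a; rewrite !inE => /and3P[-> ->].
    rewrite cardsD (setIidPr F0s) F0c; move: df; rewrite /indeg; lia.
  apply: leq_trans f0; rewrite -(cards1 j); apply: subset_leq_card.
  apply/subsetP=> a; rewrite !inE /e0 bF bj => /and3P[-> ->] /=.
  by rewrite andbT negbK.
have /source_componentP[s sV sP] := A1 _ _ F0f red0.
have isoj a b : connect e0 a b -> (a == j) = (b == j).
  case/connectP=> p pP ->; elim: p a pP => //= c p IH a /andP[ac /IH <-].
  by move: ac => /and5P[_ _ _ /negbTE-> /negbTE->].
have F0C : ~: F0 = [set j].
  have sj : s = j.
    by apply/eqP; rewrite (isoj s j) //; apply: sP; rewrite inE.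
  apply/setP=> k; rewrite in_set1; apply/idP/eqP => [kF|->]; last by rewrite inE.
  by apply/eqP; rewrite -(isoj s k (sP k kF)) sj.
(* With only [j] outside [F0], [n] is at most [f + 1]; without faulty agents all edges may then be
   removed, so a source exists only if [n <= 1], against [0 < f < n]. *)
have nf1 : n <= f.+1.
  by rewrite -[n]card_ord -(cardsC F0) F0C cards1 addn1.
have red1 : reduced_graph e set0 f (fun _ _ => false).
  split=> // b _; rewrite -ltnS; apply: leq_trans nf1.
  rewrite -[X in _ < X]card_ord -cardsT; apply: proper_card.
  apply/properP; split; first exact: subsetT.
  by exists b; rewrite !inE // e_irr.
have := A1 _ _ _ red1; rewrite cards0 => /(_ isT)/source_componentP[s' _ s'P].
have all_eq k : k = s'.
  have := s'P k; rewrite !inE => /(_ isT)/connectP[[|//] _ ->] //.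
have : n <= 1.
  rewrite -[n]card_ord -cardsT -(cards1 s'); apply: subset_leq_card.
  by apply/subsetP => k _; rewrite inE (all_eq k).
have := assumption1_card A1; lia.
Qed.

(** One round of influence: [f + 1] in-neighbours in [S] are needed for it to survive trimming. *)
Definition recruit F S : {set 'I_n} :=
  S :|: [set j in ~: F | f < #|S :&: in_nbrs e j|].

Lemma recruit_homo F S T : S \subset T -> recruit F S \subset recruit F T.
Proof.
move=> ST; apply: setUSS => //; apply/subsetP=> j; rewrite !inE.
move=> /andP[-> /leq_trans]; apply; apply: subset_leq_card; exact: setSI.
Qed.

Lemma sub_iter_recruit F S k : S \subset iter k (recruit F) S.
Proof. by elim: k => //= k /subset_trans; apply; apply: subsetUl. Qed.

(** The least fixpoint of [X |-> S :|: recruit F X] is reached after [n] iterations from the empty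
    set, and these iterates are those of [recruit F] from [S], one step late. *)
Lemma iter_recruit_stable F S :
  recruit F (iter n (recruit F) S) = iter n (recruit F) S.
Proof.
have mono : {homo (fun X => S :|: recruit F X) : X Y / X \subset Y}.
  by move=> X Y XY; apply: setUS; apply: recruit_homo.
pose G X := S :|: recruit F X.
have E k : iter k.+1 G set0 = iter k (recruit F) S.
  elim: k => [|k IH] /=.
    rewrite /G /recruit set0U; apply/setUidPl/subsetP => j; rewrite !inE.
    by rewrite set0I cards0 ltn0 andbF.
  rewrite -IH /= /G; apply/setUidPr; rewrite -/(G _) -/(iter k.+1 G set0) IH.
  exact: sub_iter_recruit F S k.+1.
have := fixsetK mono; rewrite /fixset card_ord -/G.
rewrite -[LHS]/(G (iter n G set0)) => fixE.
by have := E n.+1; have := E n; rewrite !iterS !fixE => <- <-.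
Qed.

(* Otherwise the complements of the two closures are disjoint and, in a suitable
   reduced graph, no edge enters either of them; a source would lie in both. *)
Lemma recruit_propagates F S T :
  assumption1 e f -> #|F| <= f -> S :|: T = ~: F ->
  ~: F \subset iter n (recruit F) S \/ ~: F \subset iter n (recruit F) T.
Proof.
move=> A1 Ff STF; apply/orP; rewrite -[_ || _]negbK negb_or; apply/negP.
set S' := iter n _ S; set T' := iter n _ T.
case/andP=> /subsetPn[b bF bS'] /subsetPn[a aF aT'].
pose A := ~: F :\: T'; pose B := ~: F :\: S'.
pose r : rel 'I_n := fun x y => [&& x \notin F, y \notin F, e x y,
  (y \in B) ==> (x \in B) & (y \in A) ==> (x \in A)].
(* An agent outside a stable closure hears at most [f] of its members, so the edges entering [A] or
   [B] from outside may be removed. *)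
have stable (U : {set 'I_n}) j : j \notin F -> j \notin iter n (recruit F) U ->
    #|iter n (recruit F) U :&: in_nbrs e j| <= f.
  move=> jF; rewrite -{1}iter_recruit_stable /recruit.
  by rewrite in_setU negb_or => /andP[_]; rewrite !inE jF /= -leqNgt.
have AB x : x \in A -> x \notin B.
  rewrite !inE => /andP[xT' xF]; rewrite xF andbT negbK.
  have : x \in S :|: T by rewrite STF inE.
  case/setUP=> [/(subsetP (sub_iter_recruit F S n))//|].
  move=> /(subsetP (sub_iter_recruit F T n)).
  by rewrite -/T' (negbTE xT').
have red : reduced_graph e F f r.
  split=> [x y /and5P[]//|j jF].
  have [jA|jA] := boolP (j \in A).
    apply: leq_trans (stable T j _ _) => //; last first.
      by move: jA; rewrite inE => /andP[].
    apply: subset_leq_card; apply/subsetP => x; rewrite !inE.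
    move=> /and3P[xF exj]; rewrite exj andbT /r xF jF jA exj (negbTE (AB _ jA)) /=.
    by rewrite !inE xF andbT negbK.
  have [jB|jB] := boolP (j \in B).
    apply: leq_trans (stable S j _ _) => //; last first.
      by move: jB; rewrite inE => /andP[].
    apply: subset_leq_card; apply/subsetP => x; rewrite !inE.
    move=> /and3P[xF exj]; rewrite exj andbT /r xF jF jB exj (negbTE jA) /=.
    by rewrite andbT !inE xF andbT negbK.
  rewrite (_ : [set _ | _] = set0) ?cards0 //; apply/setP=> x; rewrite !inE.
  apply/negbTE/negP => /and3P[xF exj]; rewrite /r xF jF exj.
  by rewrite (negbTE jA) (negbTE jB).
have /source_componentP[s sV sP] := A1 _ _ Ff red.
have sA : s \in A.
  apply: (connect_closed_pred (S := mem A) _ (sP a aF)) => [x y|].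
    by case/and5P=> _ _ _ _ /implyP.
  by rewrite /A /= inE aT'.
have : s \in B.
  apply: (connect_closed_pred (S := mem B) _ (sP b bF)) => [x y|].
    by case/and5P=> _ _ _ /implyP.
  by rewrite /B /= inE bS'.
by apply/negP/AB.
Qed.

End GraphLemmas.

(** * Sequences that contract up to a vanishing error *)

Section Vanishing.
Variable R : realType.
Implicit Types (a c : nat -> R) (rho eps : R).

(** One-sided form of convergence to 0; the two agree for nonnegative sequences. *)
Definition eventually_small a := forall eps, 0 < eps ->
  exists T, forall t, (T <= t)%N -> a t <= eps.

Lemma eventually_small_sum a k : eventually_small a ->
  eventually_small (fun t => \sum_(r < k) a (t + r)%N).
Proof.
move=> a0 eps eps0.
have k1 : 0 < k.+1%:R :> R by [].
have [T aT] := a0 (eps / k.+1%:R) (divr_gt0 eps0 k1).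
exists T => t Tt; apply: (@le_trans _ _ (\sum_(r < k) eps / k.+1%:R)).
  by apply: ler_sum => r _; apply: aT; rewrite (leq_trans Tt) ?leq_addr.
rewrite sumr_const card_ord -[leLHS]mulr_natr mulrAC ler_pdivrMr // ler_pM2l //.
by rewrite ler_nat.
Qed.

(** Once [c] is below [(1 - rho) * (eps / 2)], the bound on the excess of [a] over [eps / 2] shrinks
    by the factor [rho] every [k] steps. *)
Lemma eventually_small_contraction a c rho k : 0 <= rho -> rho < 1 ->
  (0 < k)%N -> (forall t, 0 <= a t) ->
  (forall t, a (t + k)%N <= rho * a t + c t) ->
  eventually_small c -> eventually_small a.
Proof.
move=> rho0 rho1 k0 a0 ak c0 eps eps0.
have eps2 : 0 < eps / 2 by rewrite divr_gt0.
have [T cT] : exists T, forall t, (T <= t)%N -> c t <= (1 - rho) * (eps / 2).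
  by apply: c0; rewrite mulr_gt0 // subr_gt0.
(* This sum dominates each of the [k] values from [T] on, so it is a common starting bound for all
   residues modulo [k]. *)
pose C := \sum_(r < k) a (T + r)%N.
have C0 : 0 <= C by apply: sumr_ge0.
have iterate q t : (T + q * k <= t)%N -> a t <= eps / 2 + rho ^+ q * C.
  elim: q t => [|q IHq] t.
    rewrite mul0n addn0 expr0 mul1r => Tt.
    have [m] := ubnP t; elim: m t Tt => // m IHm t Tt tm.
    have [tk|tk] := ltnP t (T + k).
      have r0 : (t - T < k)%N by lia.
      apply: (@le_trans _ _ C); last by rewrite lerDr ltW.
      rewrite /C (bigD1 (Ordinal r0)) //= subnKC // lerDl.
      exact: sumr_ge0.
    have -> : t = (t - k + k)%N by lia.
    apply: le_trans (ak _) _.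
    have Tk : (T <= t - k)%N by lia.
    have km : (t - k < m)%N by lia.
    have := IHm _ Tk km; have := cT _ Tk => H1 H2.
    apply: le_trans (lerD (ler_wpM2l rho0 H2) H1) _.
    have : rho * C <= C by rewrite ler_piMl // ltW.
    lra.
  rewrite mulSn => Tt; have -> : t = (t - k + k)%N by lia.
  have Tk : (T + q * k <= t - k)%N by lia.
  have Tk' : (T <= t - k)%N by lia.
  apply: le_trans (ak _) _.
  apply: le_trans (lerD (ler_wpM2l rho0 (IHq _ Tk)) (cT _ Tk')) _.
  by rewrite exprS -mulrA; lra.
(* [C] may be 0, whence the division by [C + 1]. *)
have [N rhoN] : exists N, rho ^+ N * C <= eps / 2.
  have C1 : 0 < C + 1 by lra.
  have /cvgrPdist_lt/(_ (eps / 2 / (C + 1))) : rho ^+ m @[m --> \oo] --> 0.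
    by apply: cvg_expr; rewrite ger0_norm.
  rewrite divr_gt0 // => /(_ isT)[N _ /(_ N (leqnn N))] /=.
  rewrite sub0r normrN ger0_norm ?exprn_ge0 // => rN.
  exists N; apply: (@le_trans _ _ (eps / 2 / (C + 1) * C)).
    by apply: ler_wpM2r => //; exact: ltW.
  rewrite mulrAC ler_pdivrMr // ler_pM2l //; lra.
exists (T + N * k)%N => t /iterate; lra.
Qed.

End Vanishing.

(** * Consensus: contraction of the range of the non-faulty states *)

Section Consensus.
Variables (R : realType) (n f : nat) (e : rel 'I_n) (F : {set 'I_n}).
Implicit Types (x : nat -> 'I_n -> R) (b : nat -> R) (xi : R).

(** The index [j0] only certifies that a non-faulty agent exists. Minima are written as minus the
    [top] of the negated states. *)
Definition top (j0 : 'I_n) (y : 'I_n -> R) : R :=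
  y [arg max_(i > j0 | i \notin F) y i]%O.

Lemma top_ge j0 y i : j0 \notin F -> i \notin F -> y i <= top j0 y.
Proof. by move=> j0F iF; rewrite /top; case: arg_maxP => // k _; apply. Qed.

Lemma top_ex j0 y : j0 \notin F -> exists2 i, i \notin F & top j0 y = y i.
Proof. by move=> j0F; rewrite /top; case: arg_maxP => // k ? _; exists k. Qed.

(* One step of the iteration, seen from above: a non-faulty agent that lies
   [eta] below the upper bound [M], or that hears more than [f] such non-faulty
   agents, ends up [xi * eta] below [M], up to the perturbation [b t]. *)
Definition damped xi b x := forall t j M eta, j \notin F -> 0 <= eta ->
  (forall i, i \notin F -> x t i <= M) ->
  x t j <= M - eta \/
    (f < #|([set i in ~: F | (x t i <= M - eta)%R] :&: in_nbrs e j)%SET|)%N ->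
  x t.+1 j <= M - xi * eta + b t.

(** An agent that is behind the upper bound stays behind by a fixed proportion and pulls its
    recruits along; the bound itself drifts only by the accumulated perturbations. *)
Lemma damped_iter xi b x s M eta (S : {set 'I_n}) : 0 <= xi ->
  (forall t, 0 <= b t) ->
  damped xi b x -> 0 <= eta ->
  (forall i, i \notin F -> x s i <= M) ->
  (forall i, i \in S -> i \notin F /\ x s i <= M - eta) ->
  forall k, (forall i, i \notin F ->
      x (s + k)%N i <= M + \sum_(r < k) b (s + r)%N) /\
    (forall i, i \in iter k (recruit f e F) S -> i \notin F /\
      x (s + k)%N i <= M - xi ^+ k * eta + \sum_(r < k) b (s + r)%N).
Proof.
move=> xi0 b0 dx eta0 xM xS; elim=> [|k [IHM IHS]].
  rewrite big_ord0 addn0; split=> [i iF|i /xS[iF xi_le]].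
    by rewrite addr0; apply: xM.
  by rewrite expr0 mul1r addr0; split.
rewrite big_ord_recr /=; set E := \sum_(r < k) _ in IHM IHS *.
have eta0' : 0 <= xi ^+ k * eta by rewrite mulr_ge0 // exprn_ge0.
split=> [i iF|i].
  (* [damped] with [eta = 0] propagates the upper bound. *)
  rewrite addnS; have := dx _ i (M + E) 0 iF (lexx _) IHM.
  by rewrite subr0 mulr0 subr0 addrA; apply; left; exact: IHM.
move=> iE.
have iF : i \notin F.
  move: iE; rewrite /recruit finset.in_setU => /orP[/IHS[]//|].
  by rewrite !inE => /andP[].
split=> //; rewrite addnS.
have := dx _ i (M + E) (xi ^+ k * eta) iF eta0' IHM.
rewrite exprS -mulrA => H; apply: le_trans (H _) _; last by lra.
move: iE; rewrite /recruit finset.in_setU => /orP[/IHS[_]|]; first by left; lra.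
rewrite !inE => /andP[_ fk]; right; apply: leq_trans fk _.
apply: subset_leq_card; apply: finset.setSI; apply/fintype.subsetP => l lE.
have [lF ll] := IHS _ lE.
by rewrite !inE lF /=; lra.
Qed.

Variable j0 : 'I_n.
Hypothesis j0F : j0 \notin F.
Hypothesis A1 : assumption1 e f.
Hypothesis Ff : (#|F| <= f)%N.

Let spread x t := top j0 (x t) + top j0 (fun i => - x t i).

Lemma spread_ge0 x t : 0 <= spread x t.
Proof.
have := top_ge (x t) j0F j0F; have := top_ge (fun i => - x t i) j0F j0F.
rewrite /spread; lra.
Qed.

(* Compare with the midpoint of the current range: by [recruit_propagates] the
   agents on one side of it influence everybody within [n] steps. *)
Lemma spread_contraction xi b x s : 0 <= xi -> (forall t, 0 <= b t) ->
  damped xi b x -> damped xi b (fun t i => - x t i) ->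
  spread x (s + n)%N <=
    (1 - xi ^+ n / 2) * spread x s + 2 * \sum_(r < n) b (s + r)%N.
Proof.
move=> xi0 b0 dx dNx.
set M := top j0 (x s); set m := top j0 (fun i => - x s i).
have xM i : i \notin F -> x s i <= M by apply: top_ge.
have xm i : i \notin F -> - x s i <= m by apply: (@top_ge j0 (fun i => - x s i)).
(* As [m] is minus the least state, [M - eta] is the midpoint of the range. *)
pose eta := (M + m) / 2.
have eta0 : 0 <= eta by rewrite divr_ge0 //; apply: spread_ge0.
pose S : {set 'I_n} := [set i in ~: F | x s i <= M - eta]%SET.
pose T : {set 'I_n} := [set i in ~: F | ~~ (x s i <= M - eta)]%SET.
have ST : (S :|: T)%SET = (~: F)%SET.
  by apply/setP=> i; rewrite !inE; case: (i \in F) => //=; rewrite orbN.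
have SP i : i \in S -> i \notin F /\ x s i <= M - eta.
  by rewrite !inE => /andP.
have TP i : i \in T -> i \notin F /\ - x s i <= m - eta.
  rewrite !inE -ltNge => /andP[iF xi_gt]; split=> //.
  by move: xi_gt; rewrite /eta; lra.
have [upS allS] := damped_iter xi0 b0 dx eta0 xM SP n.
have [upT allT] := damped_iter xi0 b0 dNx eta0 xm TP n.
set E := \sum_(r < n) _ in upS allS upT allT *.
have [i iF topi] := top_ex (x (s + n)%N) j0F.
have [j jF topj] := top_ex (fun i => - x (s + n)%N i) j0F.
rewrite /spread topi topj -/M -/m.
have -> : (1 - xi ^+ n / 2) * (M + m) + 2 * E = M + m - xi ^+ n * eta + 2 * E.
  by rewrite /eta; field.
have jlo := upT j jF; have iup := upS i iF.
have [/fintype.subsetP sub|/fintype.subsetP sub] :=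
  recruit_propagates A1 Ff ST.
  have [|_ H] := allS i; first by apply: sub; rewrite inE.
  lra.
have [|_ H] := allT j; first by apply: sub; rewrite inE.
lra.
Qed.

Lemma spread_vanishes xi b x : 0 < xi -> xi <= 1 -> (forall t, 0 <= b t) ->
  eventually_small b ->
  damped xi b x -> damped xi b (fun t i => - x t i) ->
  eventually_small (spread x).
Proof.
move=> xi0 xi1 b0 bs dx dNx.
have xin0 : 0 < xi ^+ n by rewrite exprn_gt0.
have xin1 : xi ^+ n <= 1 by rewrite exprn_ile1 // ltW.
apply: (@eventually_small_contraction _ (spread x)
  (fun t => 2 * \sum_(r < n) b (t + r)%N) (1 - xi ^+ n / 2) n).
- by lra.
- by lra.
- exact: leq_ltn_trans (ltn_ord j0).
- by move=> t; apply: spread_ge0.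
- by move=> t; apply: spread_contraction => //; apply: ltW.
move=> eps eps0; have [|T bT] := eventually_small_sum n bs (eps := eps / 2).
  by rewrite divr_gt0.
by exists T => t /bT; lra.
Qed.

End Consensus.

(** * Counting in trimmed sorted lists *)

Section Trim.

Lemma trim_rev (T : Type) f (s : seq T) : (2 * f <= size s)%N ->
  trim f (rev s) = rev (trim f s).
Proof.
move=> fs; rewrite /trim size_rev take_rev drop_rev; congr rev.
rewrite size_drop !take_drop subKn; last lia.
by congr (drop _ (take _ _)); lia.
Qed.

Lemma trim_map (T U : Type) (h : T -> U) f (s : seq T) :
  trim f (map h s) = map h (trim f s).
Proof. by rewrite /trim size_map map_drop map_take. Qed.

Lemma size_trim (T : Type) f (s : seq T) : size (trim f s) = (size s - 2 * f)%N.
Proof. by rewrite /trim size_drop size_takel ?leq_subr //; lia. Qed.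

Lemma trim_subseq (T : eqType) f (s : seq T) : subseq (trim f s) s.
Proof. exact: subseq_trans (drop_subseq _ _) (take_subseq _ _). Qed.

Lemma trim_decomp (T : Type) f (s : seq T) : (2 * f <= size s)%N ->
  s = take f s ++ trim f s ++ drop (size s - f) s.
Proof.
move=> fs; rewrite catA.
have -> : take f s ++ trim f s = take (size s - f) s.
  have <- : take f (take (size s - f) s) = take f s by rewrite take_takel //; lia.
  exact: cat_take_drop.
by rewrite cat_take_drop.
Qed.

Variables (R : realType) (T : eqType).
Implicit Types (v : T -> R) (s : seq T).

(** Besides [x] itself, the [f] discarded largest entries lie at or above it. *)
Lemma trim_count_ge v f s x : sorted (fun a b => v a <= v b) s ->
  x \in trim f s -> (f < count (fun a => (v x <= v a)%R) s)%N.
Proof.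
move=> srt xs; have fs : (2 * f < size s)%N.
  by have := size_trim f s; case: (trim f s) xs => //= ? l _; lia.
rewrite (trim_decomp (ltnW fs)) !count_cat.
have tr : transitive (fun a b => v a <= v b) by move=> ? ? ?; apply: le_trans.
move: srt; rewrite sorted_pairwise // {1}(trim_decomp (ltnW fs)) !pairwise_cat.
move=> /and3P[_ _ /and3P[/allrelP H _ _]].
have -> : count (fun a => v x <= v a) (drop (size s - f) s) = f.
  have cs : size (drop (size s - f) s) = f by rewrite size_drop; lia.
  by rewrite -[RHS]cs; apply/eqP; rewrite -all_count; apply/allP => a; apply: H.
have : (0 < count (fun a => (v x <= v a)%R) (trim f s))%N.
  by rewrite -has_count; apply/hasP; exists x.
lia.
Qed.

(** [P] passes to smaller entries: if no kept entry had it, no discarded largest one would, leaving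
    only the [f] discarded smallest. *)
Lemma trim_has v f s (P : pred T) : sorted (fun a b => v a <= v b) s ->
  (forall a b, v a <= v b -> P b -> P a) ->
  (2 * f < size s)%N -> (f < count P s)%N ->
  exists2 x, x \in trim f s & P x.
Proof.
move=> srt Pv fs fc; apply/hasP; apply/negPn/negP => /hasPn none.
have tr : transitive (fun a b => v a <= v b) by move=> ? ? ?; apply: le_trans.
move: srt; rewrite sorted_pairwise // {1}(trim_decomp (ltnW fs)) !pairwise_cat.
move=> /and3P[_ _ /and3P[/allrelP H _ _]].
have [x xs] : exists x, x \in trim f s.
  by have := size_trim f s; case: (trim f s) => [/=|y l _]; [lia|exists y; rewrite mem_head].
move: fc; rewrite (trim_decomp (ltnW fs)) !count_cat.
have -> : count P (trim f s) = 0%N.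
  by apply/eqP; rewrite -leqn0 leqNgt -has_count; apply/hasPn.
have -> : count P (drop (size s - f) s) = 0%N.
  apply/eqP; rewrite -leqn0 leqNgt -has_count; apply/hasPn => y ys.
  by apply: contra (none x xs); apply: Pv; apply: H.
rewrite !addn0 ltnNge => /negP; apply; apply: leq_trans (count_size _ _) _.
by rewrite size_take; case: ltnP; lia.
Qed.

Lemma sorted_revN v s : sorted (fun a b => v a <= v b) s ->
  sorted (fun a b => - v a <= - v b) (rev s).
Proof.
rewrite rev_sorted; congr (is_true (sorted _ _)).
by apply/funext=> a; apply/funext=> b; rewrite lerN2.
Qed.

End Trim.

(** * Trimmed averages of states *)

Section TrimmedMean.
Variables (R : realType) (n f : nat) (e : rel 'I_n) (F : {set 'I_n}).
Hypothesis e_irr : irreflexive e.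
Hypothesis A1 : assumption1 e f.
Hypothesis Ff : (#|F| <= f)%N.

Lemma count_enum_card (A : {set 'I_n}) (s : seq 'I_n) (P : pred 'I_n) :
  perm_eq s (enum A) -> count P s = #|[set i in A | P i]%SET|.
Proof.
move=> /permP->; rewrite -size_filter cardE; congr size.
by rewrite /enum_mem -filter_predI; apply: eq_filter => i; rewrite /= !inE andbC.
Qed.

(** More than [f] received entries, one of them non-faulty, dominate any kept entry, which is thus
    at most [M]. One averaged entry is at most [M - eta], and an average of at most [n] entries then
    drops by at least [eta / n]. *)
Lemma trimmed_mean_le (w y : 'I_n -> R) (s : seq 'I_n) j M eta :
  j \notin F -> perm_eq s (enum (in_nbrs e j)) ->
  sorted (fun a b => w a <= w b) s ->
  (forall i, i \notin F -> w i = y i) ->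
  (forall i, i \notin F -> y i <= M) -> 0 <= eta ->
  y j <= M - eta \/
    (f < #|([set i in ~: F | (y i <= M - eta)%R] :&: in_nbrs e j)%SET|)%N ->
  (\sum_(i in ([set i in trim f s] :|: [set j])%SET) w i)
    / (indeg e j + 1 - 2 * f)%N%:R <= M - n%:R^-1 * eta.
Proof.
move=> jF ps srt wy yM eta0 Hj.
have us : uniq s by rewrite (perm_uniq ps) enum_uniq.
have ss : size s = indeg e j by rewrite (perm_size ps) -cardE.
have mem_s i : i \in s -> e i j by rewrite (perm_mem ps) mem_enum inE.
have df := indeg_gt e_irr j A1.
set U := (_ :|: _)%SET; set D := (_ - _)%N.
have js : j \notin s by apply/negP => /mem_s; rewrite e_irr.
(* As [j] is not its own in-neighbour, the denominator is exactly the number of averaged entries. *)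
have UD : #|U| = D.
  rewrite /U finset.setUC cardsU1 !inE.
  rewrite (contra (mem_subseq (trim_subseq f s) (x := j))) //.
  rewrite cardsE (card_uniqP (subseq_uniq (trim_subseq f s) us)) size_trim ss.
  rewrite /D; lia.
have D0 : (0 < D)%N by rewrite -UD; apply/card_gt0P; exists j; rewrite !inE eqxx orbT.
have Dn : (D <= n)%N by rewrite -UD -[leqRHS]card_ord; apply: max_card.
have wM i : i \in U -> w i <= M.
  rewrite !inE => /orP[iT|/eqP->]; last by rewrite wy // yM.
  have := trim_count_ge srt iT; rewrite (count_enum_card _ ps) => fc.
  have /subsetPn[k] : ~~ ([set a in in_nbrs e j | (w i <= w a)%R]%SET \subset F).
    by apply/negP => /subset_leq_card; lia.
  by rewrite inE => /andP[_ wik] kF; rewrite (le_trans wik) // wy // yM.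
have [k kU wk] : exists2 k, k \in U & w k <= M - eta.
  case: Hj => [yj|fc]; first by exists j; [rewrite !inE eqxx orbT|rewrite wy].
  have fc' : (f < count (fun a => (w a <= M - eta)%R) s)%N.
    rewrite (count_enum_card _ ps); apply: leq_trans fc _.
    apply: subset_leq_card; apply/fintype.subsetP => i.
    by rewrite !inE => /andP[/andP[iF yi] ->] /=; rewrite wy.
  have [a b wab||k ks wk] := trim_has srt _ _ fc'; first exact: le_trans wab.
    by have := count_size (fun a => w a <= M - eta) s; rewrite ss; lia.
  by exists k; rewrite // !inE ks.
have sumU : \sum_(i in U) w i <= D%:R * M - eta.
  have -> : D%:R * M = M + \sum_(i in U | i != k) M.
    by rewrite mulr_natl -UD -sumr_const (bigD1 k).
  rewrite (bigD1 k) //=.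
  have : \sum_(i in U | i != k) w i <= \sum_(i in U | i != k) M.
    by apply: ler_sum => i /andP[/wM].
  by move: wk; lra.
have D0' : 0 < D%:R :> R by rewrite ltr0n.
rewrite ler_pdivrMr //; apply: le_trans sumU _.
rewrite mulrBl mulrC lerD2l lerN2 -mulrA mulrC -mulrA ler_piMr // mulrC.
by rewrite mulrC ler_pdivrMr ?mul1r ?ler_nat // ltr0n (leq_trans D0).
Qed.

End TrimmedMean.

(** * Weighted non-faulty gradients bounding a trimmed gradient *)

Section TrimmedGradient.
Variables (R : realType) (n f : nat) (e : rel 'I_n) (F : {set 'I_n}).

(** Half the mass sits on the agent [k.2], the other half is uniform on [k.1], matching the midpoint
    of the extreme kept gradients. The pairs [k] form a finite type. *)
Definition half_weight (k : {set 'I_n} * 'I_n) (i : 'I_n) : R :=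
  (i == k.2)%:R / 2 + (i \in k.1)%:R / (2 * #|k.1|%:R).

Lemma half_weight_sum (S : {set 'I_n}) i0 (y : 'I_n -> R) : i0 \notin F -> S \subset ~: F ->
  \sum_(i in ~: F) half_weight (S, i0) i * y i =
  y i0 / 2 + (\sum_(i in S) y i) / (2 * #|S|%:R).
Proof.
move=> i0F SF; rewrite /half_weight /=.
under eq_bigr do rewrite mulrDl.
rewrite big_split /=; congr (_ + _).
  rewrite (bigD1 i0) ?inE //= eqxx big1 ?addr0 => [|i /andP[_ /negbTE->]].
    by rewrite mulrC mul1r.
  by rewrite !mul0r.
rewrite (bigID (mem S)) /= [X in _ + X]big1 ?addr0; last first.
  by move=> i /andP[_ /negbTE->]; rewrite !mul0r.
rewrite mulr_suml; apply: eq_big => [i|i /andP[_ ->]].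
  by case: (boolP (i \in S)) => [/(fintype.subsetP SF)->|]; rewrite ?andbF.
by rewrite mul1r mulrC.
Qed.

Hypothesis e_irr : irreflexive e.
Hypothesis A1 : assumption1 e f.
Hypothesis Ff : (#|F| <= f)%N.

Lemma sorted_le_last (V : seq R) a : sorted <=%R V -> a \in V -> a <= last 0 V.
Proof.
move=> srt aV; rewrite -nth_last -[leLHS](nth_index 0 aV).
apply: (sorted_leq_nth le_trans le_refl) => //; rewrite ?inE ?index_mem //.
  by case: V aV {srt}.
by rewrite -ltnS (leq_trans _ (leqSpred _)) // index_mem.
Qed.

Lemma eff_deg_gt0 j : (0 < eff_deg e f F j)%N.
Proof.
have := indeg_gt e_irr j A1; rewrite /eff_deg.
have : (#|(in_nbrs e j :&: F)%SET| <= #|F|)%N by rewrite subset_leq_card // subsetIr.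
lia.
Qed.

Lemma closed_nbr_card j : #|(j |: in_nbrs e j)%SET| = (indeg e j).+1.
Proof. by rewrite cardsU1 inE e_irr. Qed.

Lemma closed_nbr_honest j : j \notin F ->
  #|(j |: in_nbrs e j) :\: F|%SET = (eff_deg e f F j + f)%N.
Proof.
move=> jF; have := closed_nbr_card j; rewrite -(cardsID F (j |: in_nbrs e j)%SET).
have -> : ((j |: in_nbrs e j) :&: F = in_nbrs e j :&: F)%SET.
  apply/setP=> i; rewrite !inE; case: eqP => [->|] //=.
  by rewrite (negbTE jF) andbF.
(* Positivity of [eff_deg] makes its truncated subtractions exact. *)
by have := eff_deg_gt0 j; rewrite /eff_deg; lia.
Qed.

(* The smallest kept gradient dominates some non-faulty one, and the largest kept
   gradient dominates all non-faulty ones but [f]. *)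
Lemma trimmed_gradient_ge (v y : 'I_n -> R) (V : seq R) j : j \notin F ->
  sorted <=%R V -> perm_eq V [seq v i | i <- enum (j |: in_nbrs e j)%SET] ->
  (forall i, i \notin F -> v i = y i) ->
  exists (S : {set 'I_n}) i0, [/\ i0 \notin F, S \subset ~: F, #|S| = eff_deg e f F j &
    \sum_(i in ~: F) half_weight (S, i0) i * y i <=
    (last 0 (trim f V) + head 0 (trim f V)) / 2].
Proof.
move=> jF srt pV vy; set J := (j |: in_nbrs e j)%SET.
have szV : size V = (indeg e j).+1.
  by rewrite (perm_size pV) size_map -cardE closed_nbr_card.
have df := indeg_gt e_irr j A1.
have fV : (2 * f < size V)%N by rewrite szV; lia.
have cV P : count P V = #|[set i in J | P (v i)]%SET|.
  by rewrite (permP pV) count_map -(count_enum_card _ (perm_refl (enum J))).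
have srtT : sorted <=%R (trim f V).
  by apply: (subseq_sorted _ (trim_subseq f V) srt) => ? ? ?; apply: le_trans.
have srtN : sorted (fun a b : R => - a <= - b) (rev V) := sorted_revN (v := id) srt.
have szT : (0 < size (trim f V))%N by rewrite size_trim; lia.
have headT : head 0 (trim f V) \in trim f V by rewrite -nth0 mem_nth.
have [i0 i0F yi0] : exists2 i0, i0 \notin F & y i0 <= head 0 (trim f V).
  (* In reverse order: more than [f] gradients lie at or below the smallest kept one, so one of them
     is non-faulty. *)
  have := @trim_count_ge _ _ (fun a : R => - a) f _ (head 0 (trim f V)) srtN.
  rewrite (trim_rev (ltnW fV)) mem_rev => /(_ headT); rewrite count_rev cV /= => fc.
  have /subsetPn[k] : ~~ ([set i in J | (- head 0 (trim f V) <= - v i)%R]%SET \subset F).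
    apply/negP => /subset_leq_card Hc.
    by have := leq_ltn_trans (leq_trans Hc Ff) fc; rewrite ltnn.
  by rewrite inE lerN2 => /andP[_ vk] kF; exists k; rewrite // -vy.
pose S0 := [set i in J :\: F | (v i <= last 0 (trim f V))%R]%SET.
have S0c : (eff_deg e f F j <= #|S0|)%N.
  (* Otherwise more than [f] non-faulty gradients exceed the largest kept one, and then some kept
     entry does too. *)
  rewrite leqNgt; apply/negP => S0c.
  have fc : (f < count (fun a => (last 0 (trim f V) < a)%R) (rev V))%N.
    rewrite count_rev cV /=; have := closed_nbr_honest jF.
    pose B := [set i | (v i <= last 0 (trim f V))%R]%SET.
    rewrite -/J -(cardsID B).
    have -> : ((J :\: F) :&: B)%SET = S0 by apply/setP => i; rewrite !inE.
    move=> cJ; have : (f < #|(J :\: F) :\: B|%SET)%N by rewrite -(ltn_add2l #|S0|) cJ ltn_add2r.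
    move/leq_trans; apply; apply: subset_leq_card; apply/fintype.subsetP => i.
    by rewrite !inE -ltNge => /and3P[-> _ ->].
  have [a b||x] := trim_has srtN _ _ fc; rewrite ?size_rev //.
    by rewrite lerN2 => ba /lt_le_trans; apply.
  rewrite (trim_rev (ltnW fV)) mem_rev => /(sorted_le_last srtT).
  by rewrite leNgt => /negP.
have [S SS0 Sc] := subset_of_card S0c.
have SF : S \subset ~: F.
  apply: fintype.subset_trans SS0 _; apply/fintype.subsetP => i.
  by rewrite !inE => /andP[/andP[]].
exists S, i0; split=> //; rewrite half_weight_sum // Sc.
have eff0 : 0 < (eff_deg e f F j)%:R :> R by rewrite ltr0n eff_deg_gt0.
have : \sum_(i in S) y i <= (eff_deg e f F j)%:R * last 0 (trim f V).
  rewrite mulr_natl -Sc -sumr_const; apply: ler_sum => i iS.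
  move/fintype.subsetP: SS0 => /(_ i iS); rewrite inE => /andP[iJ vi].
  by rewrite -vy //; move: iJ; rewrite inE => /andP[].
move=> sumS.
have : (\sum_(i in S) y i) / (2 * (eff_deg e f F j)%:R) <= last 0 (trim f V) / 2.
  rewrite ler_pdivrMr; last by rewrite mulr_gt0.
  by apply: le_trans sumS _; lra.
by move: yi0; lra.
Qed.

End TrimmedGradient.

(** * Descent driven by divergent stepsizes *)

Section Descent.
Variable R : realType.

(** Divergence of the stepsizes forces [M] below [a] at some time; afterwards it can overshoot [a]
    by at most [eta], since it decreases whenever it is above [a]. *)
Lemma eventually_below (M lam : nat -> R) (a eta delta : R) (T : nat) :
  0 < delta -> 0 <= eta -> (forall t, 0 <= lam t) -> series lam @ \oo --> +oo ->
  (forall t, (T <= t)%N -> a <= M t -> M t.+1 <= M t - lam t * delta) ->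
  (forall t, (T <= t)%N -> M t < a -> M t.+1 <= a + eta) ->
  exists T', forall t, (T' <= t)%N -> M t <= a + eta.
Proof.
move=> d0 eta0 lam0 lamoo down up.
have [T1 TT1 MT1] : exists2 T1, (T <= T1)%N & M T1 < a.
  apply: contrapT => /forall2NP none.
  have Ma t : (T <= t)%N -> a <= M t.
    by move=> Tt; rewrite leNgt; case: (none t) => [/negP|/negP]; rewrite ?Tt.
  have desc k : M (T + k)%N <= M T - (series lam (T + k)%N - series lam T) * delta.
    elim: k => [|k IH]; first by rewrite addn0 subrr mul0r subr0.
    rewrite addnS (le_trans (down _ _ _)) ?Ma ?leq_addr //.
    rewrite [series lam (T + k).+1%N]/series /= big_nat_recr //=.
    by rewrite -[\sum_(0 <= _ < _) _]/(series lam (T + k)%N); move: IH; lra.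
  move/cvgryPge : lamoo => /(_ (series lam T + (M T - a + 1) / delta)) [N _ NP].
  have := NP (T + N)%N (leq_addl _ _) => /= big.
  have := desc N; have := Ma (T + N)%N (leq_addr _ _) => H1 H2.
  have : (M T - a + 1) <= (series lam (T + N)%N - series lam T) * delta.
    by rewrite -ler_pdivrMr //; move: big; lra.
  lra.
exists T1 => t /subnKC<-; elim: (t - T1)%N => [|k IH].
  by rewrite addn0; lra.
rewrite addnS; have Tk : (T <= T1 + k)%N by rewrite (leq_trans TT1) ?leq_addr.
have [H|H] := leP a (M (T1 + k)%N); last exact: up.
apply: le_trans (down _ Tk H) _.
have := mulr_ge0 (lam0 (T1 + k)%N) (ltW d0); lra.
Qed.

End Descent.

(** * Stationary points of monotone functions and the one-sided limit *)

Section OneSided.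
Variable R : realType.
Implicit Types (X : set R) (q : R -> R).

(** First-order optimality over [X] for a convex function with derivative [q]; at an endpoint of [X]
    the value [q c] need not vanish. *)
Definition stationary X q (c : R) := X c /\ forall y, X y -> 0 <= q c * (y - c).

Definition order_convex X := forall a b c, X a -> X b -> a <= c -> c <= b -> X c.

Lemma closed_sup X : closed X -> X !=set0 -> has_ubound X -> X (sup X).
Proof.
move=> Xc X0 Xb; have := closure_sup X0 Xb.
by rewrite -((closure_id X).1 Xc).
Qed.

Lemma closed_inf X : closed X -> X !=set0 -> has_lbound X -> X (inf X).
Proof.
move=> Xc X0 Xlb; rewrite /inf.
have NX0 : -%R @` X !=set0 by case: X0 => x Xx; exists (- x), x.
have := closed_sup (closedN Xc) NX0 (proj1 (has_lb_ubN _) Xlb).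
by case=> x Xx <-; rewrite opprK.
Qed.

Variables (X : set R) (L B : R).
Hypothesis X_closed : closed X.
Hypothesis X_itv : order_convex X.

(** Properties of the derivatives [dh i] that pass to convex combinations and reflections with the
    same [L] and [B]. The last one is the form in which compactness of the sets of minimisers is
    used. *)
Definition regular q := [/\
  forall x y, X x -> X y -> x <= y -> q x <= q y,
  forall x y, X x -> X y -> `|q x - q y| <= L * `|x - y|,
  forall x, X x -> `|q x| <= L &
  forall x, X x -> (B < x -> 0 < q x) /\ (x < - B -> q x < 0)].

Lemma regular_ivt q a b : regular q -> X a -> X b -> a <= b ->
  q a <= 0 -> 0 <= q b -> exists2 c, a <= c <= b & q c = 0.
Proof.
move=> [mono lip bd _] Xa Xb ab qa qb.
have L0 : 0 <= L by rewrite (le_trans _ (bd _ Xa)).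
have cont : {within `[a, b], continuous q}.
  apply/subspace_continuousP => x /=; rewrite in_itv /= => /andP[ax xb].
  have Xx : X x by apply: X_itv ax xb.
  apply/cvgrPdist_le => eps eps0.
  have L1 : 0 < L + 1 by lra.
  near=> y; have : y \in `[a, b]%R by near: y; apply: withinT.
  rewrite in_itv /= => /andP[ay yb].
  apply: le_trans (lip _ _ Xx (X_itv Xa Xb ay yb)) _.
  have xy : `|x - y| <= eps / (L + 1).
    near: y; apply: cvg_within; apply/nbhs_ballP.
    by exists (eps / (L + 1)); [exact: divr_gt0|move=> y /ltW].
  apply: le_trans (ler_wpM2l L0 xy) _.
  rewrite mulrCA ger_pMr // ler_pdivrMr //; lra.
have [|c] := @IVT _ q a b 0 ab cont.
  by rewrite ge_min qa le_max qb orbT.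
by rewrite in_itv /=; exists c.
Unshelve. all: by end_near. Qed.

(** Either [q] becomes positive further right and has a zero in between, or coercivity bounds [X]
    above and its supremum is stationary. *)
Lemma stationary_above q c0 : regular q -> X c0 -> q c0 <= 0 ->
  exists2 c, stationary X q c & c0 <= c.
Proof.
move=> rq Xc0 q0; have [mono _ _ coer] := rq.
have [[b [Xb cb qb]]|none] := pselect (exists b, [/\ X b, c0 <= b & 0 < q b]).
  have [c /andP[c0c cb'] qc] := regular_ivt rq Xc0 Xb cb q0 (ltW qb).
  exists c => //; split=> [|y _]; last by rewrite qc mul0r.
  exact: X_itv Xc0 Xb c0c cb'.
have qneg b : X b -> c0 <= b -> q b <= 0.
  by move=> Xb cb; rewrite leNgt; apply/negP => qb; apply: none; exists b.
have Xub : has_ubound X.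
  exists (Num.max c0 B) => y Xy; rewrite le_max.
  have [//|/ltW yc] := leP y c0.
  rewrite leNgt; apply/orP; right; apply/negP => By.
  by have := (coer _ Xy).1 By; rewrite ltNge qneg.
have X0 : X !=set0 by exists c0.
have c0s : c0 <= sup X by apply: ub_le_sup.
have Xs := closed_sup X_closed X0 Xub.
exists (sup X) => //; split=> // y Xy.
by rewrite -mulrNN mulr_ge0 ?oppr_ge0 ?qneg // subr_le0 ub_le_sup.
Qed.

(** If [q] is positive on all of [X], coercivity bounds [X] below and its infimum is stationary. *)
Lemma stationary_exists q : X !=set0 -> regular q ->
  exists c, stationary X q c.
Proof.
move=> X0 rq; have [_ _ _ coer] := rq.
have [[c [Xc qc]]|none] := pselect (exists c, X c /\ q c <= 0).
  by have [c' ? _] := stationary_above rq Xc qc; exists c'.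
have qpos b : X b -> 0 < q b.
  by move=> Xb; rewrite ltNge; apply/negP => qb; apply: none; exists b.
have Xlb : has_lbound X.
  exists (- B) => y Xy; rewrite leNgt; apply/negP => yB.
  by have := (coer _ Xy).2 yB; rewrite ltNge ltW ?qpos.
have Xi : X (inf X) by apply: closed_inf.
exists (inf X); split=> // y Xy.
apply: mulr_ge0; first exact: ltW (qpos _ Xi).
by rewrite subr_ge0; apply: ge_inf.
Qed.

(* Beyond the stationary points all the [q k] are bounded below by a positive
   constant, so the divergence of the stepsizes pulls [M] back. *)
Lemma one_sided (K : finType) (k0 : K) (q : K -> R -> R) (M m lam : nat -> R) :
  (forall k, regular (q k)) ->
  (forall t, X (M t)) -> (forall t, X (m t)) ->
  eventually_small (fun t => M t - m t) ->
  (forall t, 0 < lam t) -> eventually_small lam -> series lam @ \oo --> +oo ->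
  (forall t, exists k, forall u, X u -> M t - lam t * q k (m t) <= u ->
    M t.+1 <= u) ->
  forall eps, 0 < eps -> exists T, forall t, (T <= t)%N ->
    exists2 y, (exists k, stationary X (q k) y) & M t <= y + eps.
Proof.
move=> rq XM Xm Mm lam0 lams lamoo step eps eps0.
pose S := [set y | exists k, stationary X (q k) y].
have X0 : X !=set0 by exists (M 0%N).
have Sub : has_ubound S.
  (* A stationary point beyond [B] is the least element of [X], hence at most [M 0]. *)
  exists (Num.max B (M 0%N)) => y [k [Xy sy]]; rewrite le_max.
  have [//|By] := leP y B; have [_ _ _ coer] := rq k.
  have := sy _ (XM 0%N).
  by rewrite pmulr_rge0 ?((coer _ Xy).1 By) // subr_ge0 => ->.
have S0 : S !=set0.
  by have [c sc] := stationary_exists X0 (rq k0); exists c, k0.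
have eps4 : 0 < eps / 4 by lra.
have [y0 [ky sy0] y0s] := sup_adherent eps4 (conj S0 Sub).
have Xy0 := sy0.1.
(* By the choice of [y0], this exceeds every stationary point. *)
pose c0 := y0 + eps / 4.
suff [T TP] : exists T, forall t, (T <= t)%N -> M t <= y0 + eps / 2 + eps / 4.
  by exists T => t /TP Mt; exists y0; [exists ky|lra].
(* If [c0] is not in the interval [X], all of [X] lies below it. *)
have [Xc0|nXc0] := pselect (X c0); last first.
  exists 0%N => t _; rewrite leNgt; apply/negP => Mt; apply: nXc0.
  by apply: (X_itv Xy0 (XM t)); rewrite /c0; lra.
have qpos k : 0 < q k c0.
  rewrite ltNge; apply/negP => qk.
  have [c sc c0c] := stationary_above (rq k) Xc0 qk.
  have : c <= sup S by apply: ub_le_sup => //; exists k.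
  move: c0c y0s; rewrite /c0; lra.
have [delta d0 dq] : exists2 delta, 0 < delta & forall k, delta <= q k c0.
  pose kmin := [arg min_(k < k0) q k c0]%O.
  exists (q kmin c0) => // k; rewrite /kmin; case: arg_minP => // i _; exact.
have qL k x : X x -> q k x <= L.
  by move=> Xx; have [_ _ bd _] := rq k; rewrite (le_trans (ler_norm _)) ?bd.
have qL' k x : X x -> - L <= q k x.
  move=> Xx; have [_ _ bd _] := rq k.
  by rewrite lerNl (le_trans (ler_norm _)) // normrN bd.
have dL : delta <= L by rewrite (le_trans (dq k0)) ?qL.
have L0 : 0 < L by lra.
have [T1 T1P] := Mm _ eps4.
have [T2 T2P] := lams _ (divr_gt0 eps4 L0).
have lamL t : (T2 <= t)%N -> lam t * L <= eps / 4.
  by move/T2P; rewrite ler_pdivlMr.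
(* When [M] is at least [y0 + eps / 2] and the spread at most [eps / 4], also [m] is at least [c0],
   where gradients are at least [delta]; otherwise one step adds at most [eps / 4]. *)
apply: (@eventually_below _ M lam (y0 + eps / 2) (eps / 4) delta (maxn T1 T2)).
- exact: d0.
- exact: ltW.
- by move=> t; apply: ltW.
- exact: lamoo.
- move=> t; rewrite geq_max => /andP[/T1P Mmt /lamL lamt] aM.
  have c0m : c0 <= m t by rewrite /c0; lra.
  have [k /(_ (M t - lam t * delta))] := step t; apply.
    have lamd : lam t * delta <= lam t * L by rewrite ler_pM2l.
    apply: (X_itv Xy0 (XM t)); first lra.
    by have := mulr_gt0 (lam0 t) d0; lra.
  have [mono _ _ _] := rq k.
  rewrite lerD2l lerN2 ler_pM2l //.
  by apply: le_trans (dq k) _; apply: mono.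
- move=> t; rewrite geq_max => /andP[_ /lamL lamt] Ma.
  rewrite leNgt; apply/negP => Mt1; have [k stepk] := step t.
  suff : M t.+1 <= y0 + eps / 2 + eps / 4 by rewrite leNgt Mt1.
  apply: stepk; first by apply: (X_itv Xy0 (XM t.+1)); lra.
  have : lam t * - L <= lam t * q k (m t) by rewrite ler_pM2l // qL'.
  lra.
Qed.

End OneSided.

(** * Convex sets of the line and projection onto them *)

Lemma conv_lmodE (R : numDomainType) (a b : R) (t : {i01 R}) :
  @conv R (convex_lmodType R^o) t a b = t%:num * a + (1 - t%:num) * b.
Proof. by []. Qed.

Section Projection.
Variables (R : realType) (X : set R).

Lemma convex_set_interval : @convex_set R R^o X -> order_convex X.
Proof.
move=> cX a b c Xa Xb ac cb.
have [ab|ab] := eqVneq a b.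
  by have -> : c = a by apply/eqP; rewrite eq_le ac ab cb.
have ba : 0 < b - a.
  by rewrite subr_gt0 lt_neqAle ab /=; apply: le_trans ac cb.
have t0 : 0 <= (b - c) / (b - a) by apply: divr_ge0 (ltW ba); rewrite subr_ge0.
have t1 : (b - c) / (b - a) <= 1 by rewrite ler_pdivrMr //; lra.
have := cX a b (Itv01 t0 t1); rewrite !inE => /(_ Xa Xb).
rewrite conv_lmodE /=; congr X.
by field; rewrite gt_eqF.
Qed.

Hypotheses (X0 : X !=set0) (X_closed : closed X) (X_itv : order_convex X).

(** A point outside the interval [X] lies on one side of it, and its nearest point is the supremum
    or the infimum of [X]. *)
Lemma argmin_dist_exists y : exists p, argmin X (fun p => `|y - p|) p.
Proof.
have [Xy|nXy] := pselect (X y).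
  by exists y; split=> // z _; rewrite subrr normr0.
have [x0 Xx0] := X0.
have [x0y|yx0] := leP x0 y.
  have Xlt z : X z -> z < y.
    move=> Xz; rewrite ltNge; apply/negP => yz; apply: nXy.
    exact: X_itv Xx0 Xz x0y yz.
  have Xub : has_ubound X by exists y => z /Xlt/ltW.
  have Xs := closed_sup X_closed X0 Xub.
  exists (sup X); split=> // z Xz.
  have := ub_le_sup Xub Xz; have := Xlt _ Xz; have := Xlt _ Xs => H1 H2 H3.
  by rewrite !gtr0_norm ?subr_gt0 // lerD2l lerN2.
have Xgt z : X z -> y < z.
  move=> Xz; rewrite ltNge; apply/negP => yz; apply: nXy.
  exact: X_itv Xz Xx0 yz (ltW yx0).
have Xlb : has_lbound X by exists y => z /Xgt/ltW.
have Xs : X (inf X) by apply: closed_inf.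
exists (inf X); split=> // z Xz.
have := ge_inf Xlb Xz; have := Xgt _ Xz; have := Xgt _ Xs => H1 H2 H3.
by rewrite !ltr0_norm ?subr_lt0 // !opprB lerD2r.
Qed.

Lemma proj_onP y : argmin X (fun p => `|y - p|) (proj_on X y).
Proof. by have [p pP] := argmin_dist_exists y; apply: xgetPex; exists p. Qed.

Lemma proj_on_le y u : X u -> y <= u -> proj_on X y <= u.
Proof.
move=> Xu yu; have [_ /(_ u Xu)] := proj_onP y.
apply: contraTT; rewrite -!ltNge => uP.
by rewrite !ler0_norm; lra.
Qed.

Lemma proj_on_ge y u : X u -> u <= y -> u <= proj_on X y.
Proof.
move=> Xu yu; have [_ /(_ u Xu)] := proj_onP y.
apply: contraTT; rewrite -!ltNge => uP.
by rewrite !ger0_norm; lra.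
Qed.

(** Since [v] is itself a candidate, projecting moves [v - d] by at most [|d|]; the triangle
    inequality gives the factor 2. *)
Lemma proj_on_dist v d : X v -> `|proj_on X (v - d) - v| <= 2 * `|d|.
Proof.
move=> Xv; have [_ /(_ v Xv)] := proj_onP (v - d).
have -> : v - d - v = - d by lra.
rewrite normrN => H; set p := proj_on _ _ in H *.
have -> : p - v = - ((v - d - p) + d) by lra.
by rewrite normrN (le_trans (ler_normD _ _)) //; lra.
Qed.

End Projection.

(** * Derivatives of admissible functions *)

Section Gradient.
Variables (R : realType) (X : set R) (L : R) (h dh : R -> R).
Hypotheses (X_itv : order_convex X) (h_adm : admissible X L h dh).

Lemma admissible_chord c y t : X c -> X y -> 0 <= t -> t <= 1 ->
  h (c + t * (y - c)) <= h c + t * (h y - h c).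
Proof.
move=> Xc Xy t0 t1.
have H : h (t * y + (1 - t) * c) <= t * h y + (1 - t) * h c.
  by apply: (adm_convex h_adm (Itv01 t0 t1)); rewrite inE.
have <- : t * y + (1 - t) * c = c + t * (y - c) by lra.
by move: H; lra.
Qed.

(* Compare the difference quotient along the segment from [c] to [y], which is
   at most the slope of the chord, with its limit at [c]. *)
Lemma admissible_gradient c y : X c -> X y -> h c + dh c * (y - c) <= h y.
Proof.
move=> Xc Xy; have [->|cy] := eqVneq y c; first by rewrite subrr mulr0 addr0.
rewrite leNgt; apply/negP => hlt.
have yc0 : 0 < `|y - c| by rewrite normr_gt0 subr_eq0.
(* If [h y] were below the tangent at [c], the difference quotients along the segment would all miss
   [dh c] by at least this much. *)
pose eps := (h c + dh c * (y - c) - h y) / `|y - c|.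
have eps0 : 0 < eps by rewrite divr_gt0 // subr_gt0.
have /cvgrPdist_lt/(_ _ eps0) := adm_deriv h_adm Xc.
rewrite near_withinE /dnbhs near_withinE => /nbhs_ballP[d /= d0 dP].
pose t := Num.min 1 (d / 2 / `|y - c|).
have d2 : 0 < d / 2 / `|y - c| by rewrite !divr_gt0.
have t0 : 0 < t by rewrite lt_min ltr01 d2.
have t1 : t <= 1 by rewrite ge_min lexx.
have td : t * `|y - c| <= d / 2 by rewrite -ler_pdivlMr // ge_min lexx orbT.
pose z := c + t * (y - c).
have zc : z - c = t * (y - c) by rewrite /z; lra.
have zc0 : z - c != 0 by rewrite zc mulf_eq0 gt_eqF //= subr_eq0.
have Xz : X z.
  have [yc|yc] := leP c y.
    by apply: (X_itv Xc Xy); rewrite /z; nra.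
  by apply: (X_itv Xy Xc); rewrite /z; nra.
have := dP z; rewrite /ball /= distrC zc normrM (gtr0_norm t0).
have -> : t * `|y - c| < d by lra.
rewrite -subr_eq0 => /(_ isT zc0 Xz); rewrite ltNge => /negP; apply.
have ch := admissible_chord Xc Xy (ltW t0) t1; rewrite -/z in ch.
apply: (@le_trans _ _ (`|dh c * (z - c) - (h z - h c)| / `|z - c|)); last first.
  by rewrite -normf_div mulrBl mulfK // zc.
rewrite zc normrM (gtr0_norm t0) invfM mulrA /eps ler_pM2r ?invr_gt0 //.
rewrite ler_pdivlMr //; apply: le_trans (ler_norm _).
by move: ch; lra.
Qed.

Lemma admissible_mono x y : X x -> X y -> x <= y -> dh x <= dh y.
Proof.
move=> Xx Xy; rewrite le_eqVlt => /predU1P[->//|xy].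
have := admissible_gradient Xx Xy; have := admissible_gradient Xy Xx => H1 H2.
by rewrite -(ler_pM2r (_ : 0 < y - x)) ?subr_gt0 //; lra.
Qed.

(** Beyond a bound for the minimisers, [h] exceeds its minimum, and the gradient inequality towards
    a minimiser fixes the sign of [dh]. *)
Lemma admissible_coercive : exists2 B, 0 <= B &
  forall x, X x -> (B < x -> 0 < dh x) /\ (x < - B -> dh x < 0).
Proof.
have [M [_ MP]] := compact_bounded (adm_argmin_compact h_adm).
have {MP} B0P := MP (M + 1) (ltac:(by rewrite ltrDl)); set B0 := M + 1 in B0P.
have [a amin] := adm_argmin_nonempty h_adm.
have [Xa ha] := amin; have aB := B0P _ amin; rewrite /= in aB.
have B00 : 0 <= B0 by rewrite (le_trans _ aB).
have not_argmin x : X x -> B0 < `|x| -> h x > h a.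
  move=> Xx xB; rewrite ltNge; apply/negP => hxa.
  suff /B0P : argmin X h x by rewrite /= leNgt xB.
  by split=> // y Xy; rewrite (le_trans hxa) ?ha.
move: aB; rewrite ler_norml => /andP[aB1 aB2].
exists B0 => // x Xx; split=> xB.
  have := not_argmin x Xx (lt_le_trans xB (ler_norm x)).
  have := admissible_gradient Xx Xa; nra.
have xB' : B0 < - x by lra.
have := not_argmin x Xx; rewrite -normrN => /(_ (lt_le_trans xB' (ler_norm _))).
have := admissible_gradient Xx Xa; nra.
Qed.

Lemma admissible_regular B : (forall x, X x ->
    (B < x -> 0 < dh x) /\ (x < - B -> dh x < 0)) ->
  regular X L B dh.
Proof.
move=> BP; split=> //.
- exact: admissible_mono.
- by move=> x y Xx Xy; apply: (adm_lipschitz h_adm (x := (x, y))).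
- exact: adm_bound h_adm.
Qed.

End Gradient.

(** * Reflection of the line, exchanging upper and lower bounds *)

Section Reflection.
Variables (R : realType) (X : set R) (L B : R).

Let NX := [set x | X (- x)].

Lemma closed_reflect : closed X -> closed NX.
Proof.
move=> /closedN; congr closed; apply/seteqP; split=> x /=.
  by case=> y Xy <-; rewrite /NX /= opprK.
by rewrite /NX /= => Xx; exists (- x); rewrite ?opprK.
Qed.

Lemma interval_reflect : order_convex X -> order_convex NX.
Proof.
by move=> X_itv a b c Xa Xb ac cb; apply: (X_itv _ _ (- c) Xb Xa); rewrite lerN2.
Qed.

Lemma regular_reflect q : regular X L B q ->
  regular NX L B (fun x => - q (- x)).
Proof.
move=> [mono lip bd coer]; split=> [x y Xx Xy xy|x y Xx Xy|x Xx|x Xx].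
- by rewrite lerN2 mono // lerN2.
- by rewrite -opprD normrN (le_trans (lip _ _ Xx Xy)) // -opprD normrN.
- by rewrite normrN bd.
have [c1 c2] := coer _ Xx.
split=> xB; rewrite ?oppr_gt0 ?oppr_lt0; first by apply: c2; rewrite ltrN2.
by apply: c1; rewrite ltrNr.
Qed.

Lemma stationary_reflect q c : stationary NX (fun x => - q (- x)) c ->
  stationary X q (- c).
Proof.
move=> [Xc sc]; split=> // y Xy; have := sc (- y).
rewrite /NX /= opprK => /(_ Xy); lra.
Qed.

End Reflection.

(** * Convex combinations of gradients and minimisers of valid functions *)

Section Weights.
Variables (R : realType) (n : nat) (F : {set 'I_n}) (X : set R) (L B : R).
Implicit Types (alpha : 'I_n -> R) (q h dh : 'I_n -> R -> R).

Definition weights alpha :=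
  (forall i, i \notin F -> 0 <= alpha i) /\ \sum_(i in ~: F) alpha i = 1.

Definition wsum alpha q (x : R) := \sum_(i in ~: F) alpha i * q i x.

Lemma regular_wsum alpha q : weights alpha ->
  (forall i, regular X L B (q i)) -> regular X L B (wsum alpha q).
Proof.
move=> [a0 a1] rq; have iF i : i \in ~: F -> i \notin F by rewrite inE.
(* The sum could vanish only if all weights did, but they add up to 1. *)
have sum_pos (y : 'I_n -> R) : (forall i, 0 < y i) ->
    0 < \sum_(i in ~: F) alpha i * y i.
  move=> y0; rewrite lt_neqAle sumr_ge0 ?andbT => [|i /iF iF']; last first.
    by rewrite mulr_ge0 ?a0 // ltW.
  apply/eqP => /esym/eqP.
  rewrite psumr_eq0 => [/allP s0|i /iF iF']; last by rewrite mulr_ge0 ?a0 // ltW.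
  have : \sum_(i in ~: F) alpha i = 0.
    apply: big1 => i iFC; have := s0 i (mem_index_enum _); rewrite iFC /=.
    by rewrite mulf_eq0 (gt_eqF (y0 i)) orbF => /eqP.
  by rewrite a1 => /eqP; rewrite oner_eq0.
split=> [x y Xx Xy xy|x y Xx Xy|x Xx|x Xx].
- apply: ler_sum => i /iF iF'; have [mono _ _ _] := rq i.
  by rewrite ler_wpM2l ?a0 ?mono.
- rewrite /wsum -sumrB (le_trans (ler_norm_sum _ _ _)) // -[leRHS]mul1r -a1 mulr_suml.
  apply: ler_sum => i /iF iF'; have [_ lip _ _] := rq i.
  by rewrite -mulrBr normrM ger0_norm ?a0 // ler_wpM2l ?a0 ?lip.
- rewrite /wsum (le_trans (ler_norm_sum _ _ _)) // -[leRHS]mul1r -a1 mulr_suml.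
  apply: ler_sum => i /iF iF'; have [_ _ bd _] := rq i.
  by rewrite normrM ger0_norm ?a0 // ler_wpM2l ?a0 ?bd.
split=> xB.
  by apply: sum_pos => i; have [_ _ _ coer] := rq i; apply: (coer _ Xx).1.
rewrite -oppr_gt0 /wsum -sumrN; under eq_bigr do rewrite -mulrN.
by apply: sum_pos => i; rewrite oppr_gt0; have [_ _ _ coer] := rq i; apply: (coer _ Xx).2.
Qed.

Lemma stationary_argmin alpha h dh c : order_convex X ->
  (forall i, admissible X L (h i) (dh i)) -> weights alpha ->
  stationary X (wsum alpha dh) c ->
  argmin X (fun x => \sum_(i in ~: F) alpha i * h i x) c.
Proof.
move=> X_itv h_adm [a0 _] [Xc sc]; split=> // y Xy.
apply: (@le_trans _ _ (\sum_(i in ~: F) alpha i * h i c + wsum alpha dh c * (y - c))).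
  by rewrite lerDl sc.
rewrite /wsum mulr_suml -big_split /=; apply: ler_sum => i; rewrite inE => iF.
by have := ler_wpM2l (a0 i iF) (admissible_gradient X_itv (h_adm i) Xc Xy); lra.
Qed.

Definition valid_weights (beta : R) (gamma : nat) alpha := weights alpha /\
  (gamma <= #|[set i in (~: F)%SET | (beta <= alpha i)%R]%SET|)%N.

Lemma stationary_Yset beta gamma alpha h dh c : order_convex X ->
  (forall i, admissible X L (h i) (dh i)) -> valid_weights beta gamma alpha ->
  stationary X (wsum alpha dh) c -> Yset X h F beta gamma c.
Proof.
move=> X_itv h_adm [wa ca] sc.
exists (fun x => \sum_(i in ~: F) alpha i * h i x); last exact: stationary_argmin sc.
by have [a0 a1] := wa; exists alpha.
Qed.

Definition uniform_weight (i : 'I_n) : R := #|~: F|%:R^-1.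

(** The uniform weight is itself at least [beta], so mixing it in keeps every weight that was at
    least [beta] there. *)
Lemma valid_weights_mix beta gamma alpha t : beta <= #|~: F|%:R^-1 ->
  (0 < #|~: F|)%N -> 0 <= t -> t <= 1 -> valid_weights beta gamma alpha ->
  valid_weights beta gamma (fun i => (1 - t) * alpha i + t * uniform_weight i).
Proof.
move=> bN N0 t0 t1 [[a0 a1] ca].
have u0 i : 0 <= uniform_weight i by rewrite invr_ge0.
split; first split=> [i iF|].
- by rewrite addr_ge0 // mulr_ge0 ?a0 // subr_ge0.
- rewrite big_split /= -!mulr_sumr a1 /uniform_weight sumr_const.
  rewrite -[_^-1 *+ _]mulr_natr mulVf ?pnatr_eq0; first lra.
  by rewrite -lt0n.
apply: leq_trans ca _; apply: subset_leq_card; apply/fintype.subsetP => i.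
rewrite !inE => /andP[-> bi] /=.
have -> : beta = (1 - t) * beta + t * beta by lra.
by rewrite lerD // ler_wpM2l // subr_ge0.
Qed.

(* The set of valid weights is star-shaped around the uniform weight. *)
Lemma Yset_between beta gamma alpha1 alpha2 h dh x1 x x2 : order_convex X ->
  (forall i, admissible X L (h i) (dh i)) -> (forall i, regular X L B (dh i)) ->
  beta <= #|~: F|%:R^-1 -> (0 < #|~: F|)%N ->
  valid_weights beta gamma alpha1 -> valid_weights beta gamma alpha2 ->
  stationary X (wsum alpha1 dh) x1 -> stationary X (wsum alpha2 dh) x2 ->
  x1 < x -> x < x2 -> Yset X h F beta gamma x.
Proof.
move=> X_itv h_adm rdh bN N0 va1 va2 [Xx1 s1] [Xx2 s2] x1x xx2.
have Xx : X x by apply: (X_itv _ _ _ Xx1 Xx2); apply: ltW.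
have [mono1 _ _ _] := regular_wsum va1.1 rdh.
have [mono2 _ _ _] := regular_wsum va2.1 rdh.
(* Stationarity, tested at the other point, gives the sign of each derivative at its own point, and
   monotonicity carries it to [x]. *)
have p1 : 0 <= wsum alpha1 dh x.
  apply: le_trans (mono1 _ _ Xx1 Xx (ltW x1x)).
  by have := s1 _ Xx2; rewrite pmulr_lge0 // subr_gt0 (lt_trans x1x).
have p2 : wsum alpha2 dh x <= 0.
  apply: le_trans (mono2 _ _ Xx Xx2 (ltW xx2)) _.
  by have := s2 _ Xx1; rewrite nmulr_lge0 // subr_lt0 (lt_trans x1x).
have mixE alpha t : wsum (fun i => (1 - t) * alpha i + t * uniform_weight i) dh x
    = (1 - t) * wsum alpha dh x + t * wsum uniform_weight dh x.
  rewrite /wsum !mulr_sumr -big_split /=; apply: eq_bigr => i _.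
  by rewrite mulrDl !mulrA.
(* If the derivatives at [x] for [alpha] and for the uniform weight do not have the same strict
   sign, some mixture of the two vanishes there. *)
have key (alpha : 'I_n -> R) : valid_weights beta gamma alpha ->
    wsum alpha dh x * wsum uniform_weight dh x <= 0 -> Yset X h F beta gamma x.
  set a := wsum alpha dh x; set u := wsum uniform_weight dh x => va au.
  have [t [t0 t1 tau]] : exists t, [/\ 0 <= t, t <= 1 & (1 - t) * a + t * u = 0].
    have [aE|a0] := eqVneq a 0; first by exists 0; rewrite aE; split=> //; lra.
    have [ua|ua] := eqVneq (a - u) 0; first by exfalso; nra.
    exists (a / (a - u)).
    have [a_gt|a_le] := ltP 0 a.
      have au_gt : 0 < a - u by nra.
      split; [by rewrite divr_ge0 ?ltW| |by field].
      by rewrite ler_pdivrMr //; nra.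
    have a_lt : a < 0 by rewrite lt_neqAle a0.
    have au_lt : a - u < 0 by nra.
    split; [by rewrite mulr_le0 ?invr_le0 ?ltW| |by field].
    by rewrite ler_ndivrMr //; nra.
  apply: (stationary_Yset X_itv h_adm (valid_weights_mix bN N0 t0 t1 va)).
  by split=> // y _; rewrite mixE -/a -/u tau mul0r.
have [u0|u0] := leP 0 (wsum uniform_weight dh x).
  by apply: (key _ va2); nra.
by apply: (key _ va1); nra.
Qed.

End Weights.

(** * Validity of the half weights *)

Section HalfWeights.
Variables (R : realType) (n f : nat) (e : rel 'I_n) (F : {set 'I_n}).
Hypothesis e_irr : irreflexive e.
Hypothesis A1 : assumption1 e f.
Hypothesis Ff : (#|F| <= f)%N.

Definition half_index (k : {set 'I_n} * 'I_n) : bool :=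
  [&& k.2 \notin F, k.1 \subset (~: F)%SET &
    [exists j, (j \notin F) && (#|k.1| == eff_deg e f F j)]].

Lemma gammat_le j : j \notin F -> (gammat e f F <= eff_deg e f F j)%N.
Proof.
move=> jF; rewrite /gammat; elim: (index_enum _) (mem_index_enum j) => //= i r IH.
rewrite in_cons big_cons => /predU1P[<-|jr]; first by rewrite inE jF geq_minl.
by case: ifP => _; rewrite ?IH // (leq_trans (geq_minr _ _)) ?IH.
Qed.

Lemma eff_deg_le_max j : j \notin F ->
  (eff_deg e f F j <= \max_(i in ~: F) eff_deg e f F i)%N.
Proof. by move=> jF; apply: (@leq_bigmax_cond _ _ (eff_deg e f F)); rewrite inE. Qed.

(** The set [k.1] has the size of an effective degree, hence at least [gammat] members, and each
    gets at least [1 / (2 * #|k.1|)], which is at least [betat]. *)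
Lemma half_weight_valid k : half_index k ->
  valid_weights F (betat R e f F) (gammat e f F) (half_weight R k).
Proof.
case: k => S i0 /and3P[/= i0F SF /existsP[j /andP[jF /eqP Sj]]].
have S0 : 0 < #|S|%:R :> R by rewrite ltr0n Sj eff_deg_gt0.
split; first split=> [i _|].
- by rewrite /half_weight addr_ge0 // divr_ge0 // mulr_ge0.
- have := half_weight_sum (fun=> 1 : R) i0F SF.
  under eq_bigr do rewrite mulr1.
  move=> ->; rewrite sumr_const; field; exact: lt0r_neq0.
apply: leq_trans (gammat_le jF) _; rewrite -Sj.
apply: subset_leq_card; apply/fintype.subsetP => i iS.
move/fintype.subsetP: SF => /(_ i iS); rewrite !inE => -> /=.
rewrite /half_weight /= iS; apply: (@le_trans _ _ (1 / (2 * #|S|%:R))); last first.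
  by rewrite lerDr.
rewrite /betat ge_min; apply/orP; left.
rewrite !div1r lef_pV2 ?posrE ?mulr_gt0 //; last first.
  by rewrite ltr0n (leq_trans (eff_deg_gt0 e_irr A1 Ff j)) ?eff_deg_le_max.
by rewrite ler_pM2l // ler_nat Sj eff_deg_le_max.
Qed.

End HalfWeights.

(** * Estimates for one iteration *)

Section Steps.
Variables (R : realType) (n f : nat) (e : rel 'I_n) (F : {set 'I_n}).
Variables (X : set R) (dh : 'I_n -> R -> R) (lam : nat -> R).
Variables (x : nat -> 'I_n -> R) (w g : nat -> 'I_n -> 'I_n -> R).
Hypothesis e_irr : irreflexive e.
Hypothesis A1 : assumption1 e f.
Hypothesis Ff : (#|F| <= f)%N.
Hypothesis exec : execution e f F X dh lam x w g.

(** Records only the damping estimate of a trimmed average; for negated states it is the estimate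
    from below. *)
Definition averages (y : 'I_n -> R) (j : 'I_n) (v : R) := forall M eta : R,
  0 <= eta -> (forall i, i \notin F -> y i <= M) ->
  y j <= M - eta \/
    (f < #|([set i in ~: F | (y i <= M - eta)%R] :&: in_nbrs e j)%SET|)%N ->
  v <= M - n%:R^-1 * eta.

Lemma execution_average t j : j \notin F ->
  exists v, [/\ x t.+1 j = proj_on X (v - lam t * trimmed_gradient e f g t j),
    averages (x t) j v & averages (fun i => - x t i) j (- v)].
Proof.
move=> jF; have [_ honest upd] := exec.
have [R1 [s [ps srt ->]] ->] := upd t j jF.
eexists; split; first by [].
  move=> M eta eta0 yM H.
  exact: (trimmed_mean_le e_irr A1 Ff jF ps srt
    (fun i iF => (honest t i j iF).1) yM eta0 H).
move=> M eta eta0 yM H.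
have ps' : perm_eq (rev s) (enum (in_nbrs e j)) by rewrite perm_rev.
have ss : (2 * f <= size s)%N.
  rewrite (perm_size ps) -cardE -/(indeg e j).
  by have := indeg_gt e_irr j A1; lia.
have := trimmed_mean_le e_irr A1 Ff jF ps' (sorted_revN srt)
  (y := fun i => - x t i) _ yM eta0 H.
rewrite trim_rev // sumrN mulNr.
have -> : [set i in rev (trim f s)]%SET = [set i in trim f s]%SET.
  by apply/setP => i; rewrite !inE mem_rev.
by apply=> i iF; rewrite (honest t i j iF).1.
Qed.

Lemma execution_gradient t j : j \notin F ->
  (exists2 k, half_index f e F k &
    \sum_(i in ~: F) half_weight R k i * dh i (x t i) <= trimmed_gradient e f g t j) /\
  (exists2 k, half_index f e F k &
    trimmed_gradient e f g t j <= \sum_(i in ~: F) half_weight R k i * dh i (x t i)).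
Proof.
move=> jF; have [_ honest _] := exec.
have index_ok (S : {set 'I_n}) i0 : i0 \notin F -> S \subset (~: F)%SET ->
    #|S| = eff_deg e f F j -> half_index f e F (S, i0).
  move=> i0F SF Sj; rewrite /half_index /= i0F SF /=.
  by apply/existsP; exists j; rewrite jF Sj eqxx.
rewrite /trimmed_gradient /kept_gradients.
set V := sort _ _.
have srt : sorted <=%R V by apply: sort_sorted; exact: le_total.
have pV : perm_eq V [seq g t i j | i <- enum (j |: in_nbrs e j)%SET].
  by rewrite perm_sort.
split.
  have [S [i0 [i0F SF Sj H]]] := trimmed_gradient_ge e_irr A1 Ff jF srt pV
    (y := fun i => dh i (x t i)) (fun i iF => (honest t i j iF).2).
  by exists (S, i0); first exact: index_ok.
(* The upper bound is the lower one for the negated gradients in reverse order, which exchanges the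
   first and last kept entries. *)
pose V' := rev (map -%R V).
have srt' : sorted <=%R V'.
  rewrite rev_sorted sorted_map; apply: sub_sorted srt => a b ab /=.
  by rewrite lerN2.
have pV' : perm_eq V' [seq - g t i j | i <- enum (j |: in_nbrs e j)%SET].
  rewrite perm_rev; have := perm_map -%R pV; rewrite -map_comp; exact.
have fV : (2 * f <= size (map -%R V))%N.
  rewrite size_map (perm_size pV) size_map -cardE closed_nbr_card //.
  by have := indeg_gt e_irr j A1; lia.
have [|S [i0 [i0F SF Sj]]] := trimmed_gradient_ge e_irr A1 Ff jF srt' pV'
    (y := fun i => - dh i (x t i)).
  by move=> i iF; rewrite (honest t i j iF).2.
rewrite trim_rev // trim_map; under eq_bigr do rewrite mulrN.
rewrite sumrN => H; exists (S, i0); first exact: index_ok.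
have hN (s : seq R) : head 0 (map -%R s) = - head 0 s by case: s => //=; rewrite oppr0.
have lN (s : seq R) : last 0 (map -%R s) = - last 0 s by rewrite -[0 in LHS]oppr0 last_map.
have rl (s : seq R) : last 0 (rev s) = head 0 s by case: s => //= a s; rewrite rev_cons last_rcons.
have rh (s : seq R) : head 0 (rev s) = last 0 s by rewrite -[s in RHS]revK rl.
by move: H; rewrite rl rh hN lN; lra.
Qed.

End Steps.

(** * Upper limit of the states *)

Section UpperLimit.
Variables (R : realType) (n f : nat) (e : rel 'I_n) (F : {set 'I_n}).
Variables (X : set R) (L B : R) (dh : 'I_n -> R -> R) (lam : nat -> R).
Variables (x : nat -> 'I_n -> R) (j0 : 'I_n).
Hypothesis e_irr : irreflexive e.
Hypothesis A1 : assumption1 e f.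
Hypothesis Ff : (#|F| <= f)%N.
Hypothesis X_closed : closed X.
Hypothesis X_itv : order_convex X.
Hypothesis rdh : forall i, regular X L B (dh i).
Hypothesis j0F : j0 \notin F.
Hypothesis Xx : forall t i, i \notin F -> X (x t i).
Hypothesis spread_small : eventually_small
  (fun t => top F j0 (x t) + top F j0 (fun i => - x t i)).
Hypothesis lam0 : forall t, 0 < lam t.
Hypothesis lam_small : eventually_small lam.
Hypothesis lam_div : series lam @ \oo --> +oo.
(** Abstract form of an iteration, satisfied by the states and, after reflection, by their
    negatives. *)
Hypothesis step : forall t j, j \notin F -> exists v gr, [/\
  v <= top F j0 (x t),
  exists2 k, half_index f e F k &
    \sum_(i in ~: F) half_weight R k i * dh i (x t i) <= gr &
  forall u, X u -> v - lam t * gr <= u -> x t.+1 j <= u].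

(** The largest state fits [one_sided]: by monotonicity the gradients may be evaluated at the
    smallest state instead, and the valid indices form a finite type. *)
Lemma upper_limit eps : 0 < eps -> exists T, forall t, (T <= t)%N ->
  exists2 y, (exists2 k, half_index f e F k &
      stationary X (wsum F (half_weight R k) dh) y) &
    forall j, j \notin F -> x t j <= y + eps.
Proof.
move=> eps0; pose K := {k | half_index f e F k}.
have [v [gr [_ [k0 ik0 _] _]]] := step 0%N j0F.
pose q (k : K) := wsum F (half_weight R (val k)) dh.
have wk k : half_index f e F k -> weights F (half_weight R k).
  by move=> /(half_weight_valid R e_irr A1 Ff)[].
have rq k : regular X L B (q k) by apply: regular_wsum (rdh); apply: wk (valP k).
pose M t := top F j0 (x t); pose m t := - top F j0 (fun i => - x t i).
have XM t : X (M t) by rewrite /M; have [i iF ->] := top_ex (x t) j0F; apply: Xx.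
have Xm t : X (m t).
  by rewrite /m; have [i iF ->] := top_ex (fun i => - x t i) j0F; rewrite opprK; apply: Xx.
have mx t i : i \notin F -> m t <= x t i.
  by move=> iF; rewrite /m lerNl; apply: (top_ge (fun i => - x t i)).
have [|t|T TP] := @one_sided R X L B X_closed X_itv K (exist _ k0 ik0) q M m lam
    rq XM Xm _ lam0 lam_small lam_div _ eps eps0.
- by move=> d d0; have [T TP] := spread_small d0; exists T => t /TP; rewrite /M /m opprK.
- have [j jF Mj] := top_ex (x t.+1) j0F.
  have [v' [gr' [vM [k ik grk] xu]]] := step t jF.
  exists (exist _ k ik) => u Xu ule; rewrite /M Mj; apply: xu => //.
  apply: le_trans ule; rewrite lerD // lerN2 ler_pM2l //.
  apply: le_trans grk; apply: ler_sum => i; rewrite inE => iF.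
  have [mono _ _ _] := rdh i.
  by rewrite ler_wpM2l ?(wk k ik).1 // mono ?mx //; apply: Xx.
exists T => t /TP[y [k sk] My]; exists y; first by exists (val k); [exact: valP|].
by move=> j jF; apply: le_trans My; apply: top_ge.
Qed.

End UpperLimit.

(** * Vanishing stepsizes and combination of both limits *)

Lemma square_summable_small (R : realType) (lam : nat -> R) :
  (forall t, 0 < lam t) -> cvgn (series (fun t => lam t ^+ 2)) ->
  eventually_small lam.
Proof.
move=> lam0 /cvg_series_cvg_0/cvgrPdist_le lams eps eps0.
have [T _ TP] := lams _ (exprn_gt0 2 eps0); exists T => t Tt.
have lam0t := ltW (lam0 t); have := TP t Tt.
by rewrite /= sub0r normrN ger0_norm ?exprn_ge0 // ler_pXn2r // nnegrE ltW.
Qed.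

Theorem theorem4 (R : realType) (n f : nat) (e : rel 'I_n)
  (X : set R) (L : R) (h dh : 'I_n -> R -> R) (lam : nat -> R)
  (F : {set 'I_n})
  (x : nat -> 'I_n -> R) (w g : nat -> 'I_n -> 'I_n -> R)
  (jt : nat -> 'I_n)
  (e_irr : irreflexive e)
  (A1 : assumption1 e f)
  (X_neq0 : X !=set0) (X_closed : closed X) (X_convex : @convex_set R R^o X)
  (h_adm : forall i, admissible X L (h i) (dh i))
  (lam_step : stepsizes lam)
  (F_card : (#|F| <= f)%N)
  (exec : execution e f F X dh lam x w g)
  (Yt := Yset X h F (betat R e f F) (gammat e f F))
  (jt_nonfaulty : forall t, jt t \notin F)
  (jt_argmax : forall t j, j \notin F ->
     (Dist (x t j) Yt <= Dist (x t (jt t)) Yt)%E) :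
  (fun t => Dist (x t (jt t)) Yt) @ \oo --> 0%E.
Proof.
have X_itv := convex_set_interval X_convex.
have [lam0 _ lam_div lam_sq] := lam_step.
have lam_small := square_summable_small lam0 lam_sq.
pose j0 := jt 0%N; have j0F : j0 \notin F := jt_nonfaulty 0%N.
have L0 : 0 <= L.
  have [a Xa] := X_neq0; apply: le_trans (adm_bound (h_adm j0) Xa).
  exact: normr_ge0.
have [B rdh] : exists B, forall i, regular X L B (dh i).
  have /choice[Bi BiP] : forall i, exists B, 0 <= B /\ forall y, X y ->
      (B < y -> 0 < dh i y) /\ (y < - B -> dh i y < 0).
    by move=> i; have [B B0 BP] := admissible_coercive X_itv (h_adm i); exists B.
  (* The bounds [Bi] are nonnegative, so their sum serves all agents. *)
  exists (\sum_i Bi i) => i; apply: (admissible_regular X_itv (h_adm i)).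
  have Bi_le : Bi i <= \sum_k Bi k.
    by rewrite (bigD1 i) //= lerDl sumr_ge0 // => k _; have [] := BiP k.
  have [_ BP] := BiP i => y Xy; have [c1 c2] := BP y Xy.
  by split=> yB; [apply: c1|apply: c2]; lra.
have NF0 : (0 < #|~: F|)%N by apply/card_gt0P; exists j0; rewrite inE.
have n0 : (0 < n)%N := leq_ltn_trans (leq0n j0) (ltn_ord j0).
have Xx t i : i \notin F -> X (x t i).
  case: t => [|t] iF; first by have [] := exec.
  have [v [-> _ _]] := execution_average e_irr A1 F_card exec t iF.
  by have [] := proj_onP X_neq0 X_closed X_itv (v - lam t * trimmed_gradient e f g t i).
have wk k : half_index f e F k -> weights F (half_weight R k).
  by move=> /(half_weight_valid R e_irr A1 F_card)[].
have sum_bound k t : half_index f e F k ->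
    `|\sum_(i in ~: F) half_weight R k i * dh i (x t i)| <= L.
  move=> /wk[a0 a1]; rewrite (le_trans (ler_norm_sum _ _ _)) // -[leRHS]mul1r -a1 mulr_suml.
  apply: ler_sum => i; rewrite inE => iF; rewrite normrM ger0_norm ?a0 //.
  by rewrite ler_wpM2l ?a0 // (adm_bound (h_adm i)) //; apply: Xx.
have grad_bound t j : j \notin F -> `|trimmed_gradient e f g t j| <= L.
  move=> jF.
  have [[k1 /(sum_bound _ t) b1 g1] [k2 /(sum_bound _ t) b2 g2]] :=
    execution_gradient e_irr A1 F_card exec t jF.
  rewrite ler_norml; move: b1 b2; rewrite !ler_norml => /andP[l1 _] /andP[_ l2].
  by rewrite (le_trans l1 g1) (le_trans g2 l2).
have avg_top y j v : averages f e F y j v -> j \notin F -> v <= top F j0 y.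
  move=> av jF; have := av (top F j0 y) 0 (lexx _).
  rewrite mulr0 subr0; apply; first by move=> i; apply: top_ge.
  by left; apply: top_ge.
have Xv t j v : j \notin F -> averages f e F (x t) j v ->
    averages f e F (fun i => - x t i) j (- v) -> X v.
  move=> jF /avg_top/(_ jF) v1 /avg_top/(_ jF).
  have [i iF topi] := top_ex (x t) j0F.
  have [i' iF' topi'] := top_ex (fun i => - x t i) j0F.
  rewrite topi' lerN2 => v2; rewrite topi in v1.
  exact: X_itv (Xx t _ iF') (Xx t _ iF) v2 v1.
(* Bounds the displacement by gradient step and projection, the factor 2 coming from
   [proj_on_dist]. *)
pose b t := 2 * (lam t * L).
have b0 t : 0 <= b t by rewrite /b !mulr_ge0 // ltW.
have bs : eventually_small b.
  move=> eps eps0; have L1 : 0 < 2 * (L + 1) by lra.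
  have [T TP] := lam_small _ (divr_gt0 eps0 L1); exists T => t /TP.
  rewrite ler_pdivlMr // /b => H; apply: le_trans H.
  by have := lam0 t; nra.
have move_small t j v : j \notin F -> X v ->
    `|proj_on X (v - lam t * trimmed_gradient e f g t j) - v| <= b t.
  move=> jF Xv'; apply: le_trans (proj_on_dist X_neq0 X_closed X_itv _ Xv') _.
  by rewrite /b ler_pM2l // normrM gtr0_norm // ler_pM2l // grad_bound.
have dx : damped f e F n%:R^-1 b x.
  move=> t j M eta jF eta0 xM hear.
  have [v [-> av avN]] := execution_average e_irr A1 F_card exec t jF.
  have := move_small t j v jF (Xv t j v jF av avN).
  by rewrite ler_norml => /andP[_]; have := av M eta eta0 xM hear; lra.
have dNx : damped f e F n%:R^-1 b (fun t i => - x t i).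
  move=> t j M eta jF eta0 xM hear.
  have [v [-> av avN]] := execution_average e_irr A1 F_card exec t jF.
  have := move_small t j v jF (Xv t j v jF av avN).
  by rewrite ler_norml => /andP[+ _]; have := avN M eta eta0 xM hear; lra.
have spread_small := spread_vanishes j0F A1 F_card _ _ b0 bs dx dNx.
have {}spread_small : eventually_small
    (fun t => top F j0 (x t) + top F j0 (fun i => - x t i)).
  apply: spread_small; first by rewrite invr_gt0 ltr0n.
  by rewrite invf_le1 ?ltr0n // ler1n.
have up := @upper_limit R n f e F X L B dh lam x j0 e_irr A1 F_card X_closed X_itv
  rdh j0F Xx spread_small lam0 lam_small lam_div.
have {}up eps : 0 < eps -> exists T, forall t, (T <= t)%N ->
    exists2 y, (exists2 k, half_index f e F k &
      stationary X (wsum F (half_weight R k) dh) y) &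
    forall j, j \notin F -> x t j <= y + eps.
  apply: up => t j jF.
  have [v [xt av avN]] := execution_average e_irr A1 F_card exec t jF.
  exists v, (trimmed_gradient e f g t j); split; first exact: avg_top av jF.
    exact: (execution_gradient e_irr A1 F_card exec t jF).1.
  by move=> u Xu; rewrite xt; apply: proj_on_le.
(* The lower limit is the upper one for the reflected system. *)
pose NX := [set y | X (- y)].
pose dh' i (y : R) := - dh i (- y).
have low eps : 0 < eps -> exists T, forall t, (T <= t)%N ->
    exists2 y, (exists2 k, half_index f e F k &
      stationary X (wsum F (half_weight R k) dh) y) &
    forall j, j \notin F -> y - eps <= x t j.
  move=> eps0.
  have [|||T TP] := @upper_limit R n f e F NX L B dh' lam (fun t i => - x t i) j0
    e_irr A1 F_card (closed_reflect X_closed) (interval_reflect X_itv)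
    (fun i => regular_reflect (rdh i)) j0F _ _ lam0 lam_small lam_div _ eps eps0.
  - by move=> t i iF; rewrite /NX /= opprK; apply: Xx.
  - move=> d d0; have [T TP] := spread_small d d0; exists T => t /TP.
    rewrite addrC; congr (_ + top _ _ _ <= _).
    by apply/funext => i; rewrite opprK.
  - move=> t j jF.
    have [v [xt av avN]] := execution_average e_irr A1 F_card exec t jF.
    exists (- v), (- trimmed_gradient e f g t j); split; first exact: avg_top avN jF.
      have [_ [k ik grk]] := execution_gradient e_irr A1 F_card exec t jF.
      exists k => //; rewrite /dh'.
      under eq_bigr do rewrite opprK mulrN.
      by rewrite sumrN lerN2.
    move=> u Xu; rewrite xt mulrN -opprD lerNl => ule; rewrite lerNl.
    exact: proj_on_ge.
  exists T => t /TP[y [k ik sy] yP]; exists (- y).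
    exists k => //; apply: stationary_reflect.
    have -> // : (fun z => - wsum F (half_weight R k) dh (- z)) =
      wsum F (half_weight R k) dh'.
    apply/funext => z; rewrite /wsum /dh' -sumrN.
    by apply: eq_bigr => i _; rewrite mulrN.
  by move=> j /yP; lra.
have betaN : betat R e f F <= #|~: F|%:R^-1 by rewrite /betat !div1r ge_min lexx orbT.
have near_Y eps : 0 < eps -> exists T, forall t, (T <= t)%N -> forall j, j \notin F ->
    exists2 y, Yt y & `|x t j - y| <= eps.
  move=> eps0; have [T1 T1P] := up _ eps0; have [T2 T2P] := low _ eps0.
  exists (maxn T1 T2) => t; rewrite geq_max => /andP[/T1P[y1 [k1 ik1 s1] y1P]].
  move=> /T2P[y2 [k2 ik2 s2] y2P] j jF.
  have v1 := half_weight_valid R e_irr A1 F_card ik1.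
  have v2 := half_weight_valid R e_irr A1 F_card ik2.
  have := y1P j jF; have := y2P j jF => H2 H1.
  (* A state at or above [y1], or at or below [y2], is within [eps] of that stationary point;
     otherwise it lies strictly between the two and is itself in [Yt]. *)
  have [xy1|y1x] := leP y1 (x t j).
    exists y1; first exact: stationary_Yset X_itv h_adm v1 s1.
    by rewrite ger0_norm ?subr_ge0 //; lra.
  have [xy2|y2x] := leP (x t j) y2.
    exists y2; first exact: stationary_Yset X_itv h_adm v2 s2.
    by rewrite ler0_norm ?subr_le0 //; lra.
  exists (x t j); last by rewrite subrr normr0 ltW.
  exact: Yset_between X_itv h_adm rdh betaN NF0 v2 v1 s2 s1 y2x y1x.
have Dist_ge0 y : (0 <= Dist y Yt)%E.
  by apply: le_ereal_inf_tmp => _ [z _ <-]; rewrite lee_fin.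
(* The distance is extended-valued: it is first shown to be eventually finite. *)
apply/fine_cvgP; split.
  have [T TP] := near_Y 1 ltr01; exists T => // t /TP/(_ _ (jt_nonfaulty t))[y Yy xy].
  rewrite fin_numElt (lt_le_trans _ (Dist_ge0 _)) ?ltNy0 //=.
  apply: le_lt_trans (ltry `|x t (jt t) - y|).
  by apply: ereal_inf_lbound; exists y.
apply/cvgrPdist_le => eps eps0; have [T TP] := near_Y eps eps0.
exists T => // t /TP/(_ _ (jt_nonfaulty t))[y Yy xy].
rewrite /= sub0r normrN ger0_norm ?fine_ge0 //.
have le_eps : (Dist (x t (jt t)) Yt <= eps%:E)%E.
  apply: (@le_trans _ _ (`|x t (jt t) - y|%:E)); last by rewrite lee_fin.
  by apply: ereal_inf_lbound; exists y.
rewrite -lee_fin fineK // fin_numElt (lt_le_trans _ (Dist_ge0 _)) ?ltNy0 //=.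
exact: le_lt_trans le_eps (ltry _).
Qed.
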